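(* Let $R$ be a skew-invertible Hecke $R$-matrix of symmetry rank $p\ge2$ with $(p-1)_q+q^{p+2}\neq0$, and let $\mathcal{L}_q$ and $\mathcal{SL}_q=\mathcal{L}_q/\{Tr_qL\}$ be the corresponding modified reflection equation algebra and its quotient. Then the $\mathcal{SL}_q$ representation $\bar\theta_1$ obtained by sl-reduction from the $R$-type representation $\theta_1(L_2)=-R_{12}$ of $\mathcal{L}_q$ is equivalent to the $\mathcal{SL}_q$ representation $\bar\pi_{[p-1]}$ obtained by sl-reduction from the $\mathcal{L}_q$ representation $\pi_{[p-1]}$ in the subspace $A^{(p-1)}(R)\triangleright V^{\otimes(p-1)}$ (all defined in the context).
   Context: **Matrices.** Fix $n\ge 1$ and a nonzero $q\in\mathbb{C}$ with $q^k\ne 1$ for all integers $k\geq 1$. Put $\lambda=q-q^{-1}$, $k_q=(q^k-q^{-k})/(q-q^{-1})$. Lower indices of a matrix enumerate rows, upper indices columns. Subscripts of a matrix indicate the tensor factors in which it acts; $I$ is the unit matrix, $P$ the permutation (flip) matrix, $Tr_{(i)}$ the trace in the $i$-th factor. **$R$-matrix.** $R$ is a complex $n^2\times n^2$ matrix with: (Yang–Baxter) $R_{12}R_{23}R_{12}=R_{23}R_{12}R_{23}$; (Hecke) $(R-qI)(R+q^{-1}I)=0$; (skew-invertibility) there is $\Psi$ with $Tr_{(2)}R_{12}\Psi_{23}=P_{13}=Tr_{(2)}\Psi_{12}R_{23}$; (symmetry rank $p\in\mathbb{N}$) $A^{(p+1)}=0$ and $\mathrm{rank}\,A^{(p)}=1$,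 where $A^{(1)}=I$, $A^{(k)}_{12\dots k}=\frac{1}{k_q}A^{(k-1)}_{2\dots k}\bigl(q^{k-1}I-(k-1)_qR_{12}\bigr)A^{(k-1)}_{2\dots k}$. Put $B_1=Tr_{(2)}\Psi_{21}$, $C_1=Tr_{(2)}\Psi_{12}$; one has $BC=q^{-2p}I$ and $Tr B=Tr C=q^{-p}p_q$. **Algebras.** $\mathcal{L}_q$ is the unital associative $\mathbb{C}$-algebra generated by $l_i^{\,j}$, $1\le i,j\le n$, with relations $R_{12}L_1R_{12}L_1-L_1R_{12}L_1R_{12}=R_{12}L_1-L_1R_{12}$, $L=\|l_i^{\,j}\|$, $L_1=L\otimes I$. $Tr_q(X)=Tr(C\cdot X)$; $Tr_qL$ is central. $\mathcal{SL}_q$ is the quotient of $\mathcal{L}_q$ by the ideal generated by $Tr_qL$; it has generators $f_i^{\,j}$ obeying the same relations with $F=\|f_i^{\,j}\|$ in place of $L$, and $Tr_qF=0$. **sl-reduction.** If $\rho$ is a representation of $\mathcal{L}_q$ in a space $W$ with $\rho(Tr_qL)=\chi_1\,\mathrm{id}_W$, and $\omega=1-\lambda\chi_1/Tr C\ne0$, then $\bar\rho(f_i^{\,j})=\frac{1}{\omega}\bigl(\rho(l_i^{\,j})-\delta_i^{\,j}\frac{\chi_1}{Tr C}\mathrm{id}_W\bigr)$ is a representation of $\mathcal{SL}_q$ in $W$. **$B$-type representations.** $V$ has basis $e_1,\dots,e_n$ and $\mathcal{L}_q$ acts by $\pi(l_i^{\,j})e_k=e_iB_k^{\,j}$. A numerical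 matrix $X$ acts on $V^{\otimes k}$ by $X\triangleright e_I=\sum_JX_I^{\,J}e_J$, $e_I=e_{i_1}\otimes\dots\otimes e_{i_k}$; for an operator $\tau(x)$, $\tau^t(x)$ is the transposed matrix: $\tau(x)e_I=\sum_J(\tau^t(x))_I^{\,J}e_J$. For $k\le p$ the representation $\pi_{[k]}$ of $\mathcal{L}_q$ in $A^{(k)}\triangleright V^{\otimes k}$ is given by $\pi^t_{[k]}(l_i^{\,j})=q^{k-1}k_q\,A^{(k)}\bigl[\pi^t(l_i^{\,j})\otimes I^{\otimes(k-1)}\bigr]A^{(k)}$; there $Tr_qL$ acts as $q^{k-1-2p}k_q$. **$R$-type representation.** $\theta_1(L_2)=-R_{12}$ means that $\theta_1(l_i^{\,j})$ is the $n\times n$ matrix in the first tensor factor obtained from $-R_{12}$ by fixing the row index $i$ and column index $j$ of the second factor; $x\mapsto\theta_1(x)$ is an algebra homomorphism into $n\times n$ matrices with ordinary matrix multiplication, i.e. $\mathcal{L}_q$ acts on column vectors of size $n$. In it $Tr_qL$ acts as $-1$. Equivalence means isomorphism of $\mathcal{SL}_q$-modules. *)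

(* Defs.v *)
From HB Require Import structures.
From mathcomp Require Import all_boot all_algebra.
From mathcomp Require Import boolp.
From mathcomp Require Import monalg.

Set Implicit Arguments.
Unset Strict Implicit.
Unset Printing Implicit Defensive.

Import GRing.Theory.
Local Open Scope ring_scope.
Local Open Scope quotient_scope.

(* Operators on the k-th tensor power of an n-dimensional space, as matrices
   over the multi-indices I : {ffun 'I_k -> 'I_n}.  The row index is the lower
   multi-index and the column index is the upper one. *)
Notation tmx A n k := 'M[A]_#|{ffun 'I_k -> 'I_n}|.

Section TensorFactors.
Variables (A : nzRingType) (n : nat).

Definition tent k (X : tmx A n k) (I J : {ffun 'I_k -> 'I_n}) : A :=
  X (enum_rank I) (enum_rank J).

Definition tmk k (f : {ffun 'I_k -> 'I_n} -> {ffun 'I_k -> 'I_n} -> A) :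
    tmx A n k :=
  \matrix_(a, b) f (enum_val a) (enum_val b).

(* X acting in the tensor factors s 0, ..., s (m - 1) (s injective), in this
   order, and as the identity in the other factors. *)
Definition emb m k (s : 'I_m -> 'I_k) (X : tmx A n m) : tmx A n k :=
  tmk (fun I J =>
    if [forall a, (a \notin codom s) ==> (I a == J a)]
    then tent X [ffun a => I (s a)] [ffun a => J (s a)] else 0).

(* Tensor factors are numbered from 0, so that the subscript 12 is at2 0 1. *)
Definition at2 k (a b : 'I_k) (X : tmx A n 2) : tmx A n k :=
  emb (fun c : 'I_2 => if c == ord0 then a else b) X.

(* X (x) I (x) ... (x) I, with k factors. *)
Definition on_first k (X : 'M[A]_n) : tmx A n k :=
  tmk (fun I J => \prod_(a < k)
    if (a == 0 :> nat)%N then X (I a) (J a) else (I a == J a)%:R).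

Definition tinsert k (a : 'I_k.+1) (x : 'I_n) (I : {ffun 'I_k -> 'I_n}) :
    {ffun 'I_k.+1 -> 'I_n} :=
  [ffun b => if unlift a b is Some c then I c else x].

(* Trace in factor a; the other factors are kept in their order. *)
Definition ptr k (a : 'I_k.+1) (X : tmx A n k.+1) : tmx A n k :=
  tmk (fun I J => \sum_(x < n) tent X (tinsert a x I) (tinsert a x J)).

Definition flip : tmx A n 2 :=
  tmk (fun I J => ((I 0 == J 1) && (I 1 == J 0))%:R).

End TensorFactors.

Section RMatrix.
Variables (F : fieldType) (n : nat).
Implicit Types (q : F) (R Psi : tmx F n 2).

Definition qnum q (k : nat) : F := (q ^+ k - q ^- k) / (q - q^-1).

Definition yang_baxter R : Prop :=
  let R12 : tmx F n 3 := at2 0 1 R in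
  let R23 : tmx F n 3 := at2 1 2 R in
  R12 *m R23 *m R12 = R23 *m R12 *m R23.

Definition hecke q R : Prop := (R - q%:M) *m (R + q^-1%:M) = 0.

(* After the trace in the second factor, the flip acts in factors 1 and 3. *)
Definition skew_inverse R Psi : Prop :=
  let on12 X : tmx F n 3 := at2 0 1 X in
  let on23 X : tmx F n 3 := at2 1 2 X in
  ptr 1 (on12 R *m on23 Psi) = flip F n /\
  flip F n = ptr 1 (on12 Psi *m on23 R).

(* The value at k = 0 is irrelevant. *)
Fixpoint antisym q R (k : nat) {struct k} : tmx F n k :=
  if k is k'.+1 then
    (if k' is k''.+1 as m return tmx F n m -> tmx F n m.+1 then fun A' =>
       let A2k := emb (lift ord0) A' in
       (qnum q k''.+2)^-1 *:
         (A2k *m ((q ^+ k''.+1)%:M - qnum q k''.+1 *: at2 0 1 R) *m A2k)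
     else fun=> 1%:M) (antisym q R k')
  else 1%:M.

Definition symmetry_rank q R (p : nat) : Prop :=
  antisym q R p.+1 = 0 /\ \rank (antisym q R p) = 1%N.

Definition Bmx Psi : 'M[F]_n :=
  \matrix_(i, j) tent (ptr 1 (at2 1 0 Psi : tmx F n 2)) [ffun=> i] [ffun=> j].

Definition Cmx Psi : 'M[F]_n :=
  \matrix_(i, j) tent (ptr 1 (Psi : tmx F n 2)) [ffun=> i] [ffun=> j].

End RMatrix.

Section QuotientAlgebra.
Variables (F : fieldType) (A : algType F).

Inductive ideal_gen (S : A -> Prop) : A -> Prop :=
| ideal_gen_in x of S x : ideal_gen S x
| ideal_gen0 : ideal_gen S 0
| ideal_genD x y of ideal_gen S x & ideal_gen S y : ideal_gen S (x + y)
| ideal_genMl a x of ideal_gen S x : ideal_gen S (a * x)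
| ideal_genMr a x of ideal_gen S x : ideal_gen S (x * a).

Definition ideal_pred (S : A -> Prop) : {pred A} :=
  fun x => `[< ideal_gen S x >].

Lemma ideal_pred_zmod S : zmod_closed (ideal_pred S).
Proof.
split=> [|x y /asboolP Sx /asboolP Sy]; apply/asboolP; first exact: ideal_gen0.
by apply: ideal_genD => //; rewrite -mulN1r; apply: ideal_genMl.
Qed.

HB.instance Definition _ S :=
  GRing.isZmodClosed.Build A (ideal_pred S) (ideal_pred_zmod S).

(* Unital algebras are nontrivial in the library, hence the proof argument. *)
Definition quot_alg (S : A -> Prop) of ~ ideal_gen S 1 : Type :=
  Quotient.quot (ideal_pred S).

Variables (S : A -> Prop) (S1 : ~ ideal_gen S 1).
Local Notation Q := (quot_alg S1).
Local Notation Q0 := (Quotient.quot (ideal_pred S)).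

HB.instance Definition _ := GRing.Zmodule.copy Q Q0.

Definition quot_proj (x : A) : Q := \pi_Q0 x.
Definition quot_repr (x : Q) : A := repr (x : Q0).

Lemma quot_reprK : cancel quot_repr quot_proj.
Proof. by move=> x; rewrite /quot_proj /quot_repr reprK. Qed.

Lemma quot_projP x y : quot_proj x = quot_proj y <-> ideal_gen S (x - y).
Proof.
split=> [/eqP|Sxy]; last first.
  by apply/eqP; rewrite -Quotient.idealrBE; apply/asboolP.
by rewrite -Quotient.idealrBE => /asboolP.
Qed.

Lemma quot_repr_proj x : ideal_gen S (quot_repr (quot_proj x) - x).
Proof. by apply/quot_projP; rewrite quot_reprK. Qed.

Lemma quot_proj_zmod : zmod_morphism quot_proj.
Proof. by move=> x y; rewrite /quot_proj raddfB. Qed.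

HB.instance Definition _ :=
  GRing.isZmodMorphism.Build A Q quot_proj quot_proj_zmod.

Definition quot_mul (x y : Q) : Q := quot_proj (quot_repr x * quot_repr y).
Definition quot_scale (c : F) (x : Q) : Q := quot_proj (c *: quot_repr x).

Lemma quot_projM x y : quot_proj (x * y) = quot_mul (quot_proj x) (quot_proj y).
Proof.
apply/esym/quot_projP; set x' := quot_repr _; set y' := quot_repr _.
have -> : x' * y' - x * y = x' * (y' - y) + (x' - x) * y.
  by rewrite mulrBr mulrBl addrA subrK.
by apply: ideal_genD; [apply: ideal_genMl|apply: ideal_genMr];
  apply: quot_repr_proj.
Qed.

Lemma quot_projZ c x : quot_proj (c *: x) = quot_scale c (quot_proj x).
Proof.
apply/esym/quot_projP; rewrite -scalerBr -[_ - x]mul1r scalerAl.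
exact/ideal_genMl/quot_repr_proj.
Qed.

Lemma quot_mulA : associative quot_mul.
Proof.
move=> x y z; rewrite -[x]quot_reprK -[y]quot_reprK -[z]quot_reprK.
by rewrite -!quot_projM mulrA.
Qed.

Lemma quot_mul1 : left_id (quot_proj 1) quot_mul.
Proof. by move=> x; rewrite -[x]quot_reprK -quot_projM mul1r. Qed.

Lemma quot_mulr1 : right_id (quot_proj 1) quot_mul.
Proof. by move=> x; rewrite -[x]quot_reprK -quot_projM mulr1. Qed.

Lemma quot_mulDl : left_distributive quot_mul +%R.
Proof.
move=> x y z; rewrite -[x]quot_reprK -[y]quot_reprK -[z]quot_reprK.
by rewrite -raddfD -!quot_projM -raddfD mulrDl.
Qed.

Lemma quot_mulDr : right_distributive quot_mul +%R.
Proof.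
move=> x y z; rewrite -[x]quot_reprK -[y]quot_reprK -[z]quot_reprK.
by rewrite -raddfD -!quot_projM -raddfD mulrDr.
Qed.

Lemma quot_oner_neq0 : quot_proj 1 != 0.
Proof.
by apply/eqP; rewrite -(raddf0 quot_proj) => /quot_projP; rewrite subr0.
Qed.

HB.instance Definition _ := GRing.Zmodule_isNzRing.Build Q
  quot_mulA quot_mul1 quot_mulr1 quot_mulDl quot_mulDr quot_oner_neq0.

Lemma quot_scaleA a b x : quot_scale a (quot_scale b x) = quot_scale (a * b) x.
Proof. by rewrite -[x]quot_reprK -!quot_projZ scalerA. Qed.

Lemma quot_scale1 : left_id 1 quot_scale.
Proof. by move=> x; rewrite -[x]quot_reprK -quot_projZ scale1r. Qed.

Lemma quot_scaleDr : right_distributive quot_scale +%R.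
Proof.
move=> a x y; rewrite -[x]quot_reprK -[y]quot_reprK.
by rewrite -raddfD -!quot_projZ -raddfD scalerDr.
Qed.

Lemma quot_scaleDl x : {morph quot_scale^~ x : a b / a + b}.
Proof.
by move=> a b; rewrite -[x]quot_reprK -!quot_projZ -raddfD scalerDl.
Qed.

HB.instance Definition _ := GRing.Zmodule_isLmodule.Build F Q
  quot_scaleA quot_scale1 quot_scaleDr quot_scaleDl.

Lemma quot_proj_scalable : scalable quot_proj.
Proof. exact: quot_projZ. Qed.

HB.instance Definition _ :=
  GRing.isScalable.Build F A Q *:%R quot_proj quot_proj_scalable.

Lemma quot_proj_monoid : monoid_morphism quot_proj.
Proof. by split=> // x y; rewrite quot_projM. Qed.

HB.instance Definition _ :=
  GRing.isMonoidMorphism.Build A Q quot_proj quot_proj_monoid.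

Lemma quot_mulE x y : quot_proj x * quot_proj y = quot_proj (x * y) :> Q.
Proof. by rewrite quot_projM. Qed.

Lemma quot_scalE c x : c *: quot_proj x = quot_proj (c *: x) :> Q.
Proof. by rewrite quot_projZ. Qed.

Lemma quot_scaleAl (a : F) (x y : Q) : a *: (x * y) = (a *: x) * y.
Proof.
rewrite -[x]quot_reprK -[y]quot_reprK.
by rewrite !(quot_scalE, quot_mulE) ?quot_reprK scalerAl.
Qed.

HB.instance Definition _ := GRing.Lmodule_isLalgebra.Build F Q quot_scaleAl.

Lemma quot_scaleAr (a : F) (x y : Q) : a *: (x * y) = x * (a *: y).
Proof.
rewrite -[x]quot_reprK -[y]quot_reprK.
by rewrite !(quot_scalE, quot_mulE) ?quot_reprK scalerAr.
Qed.

HB.instance Definition _ := GRing.Lalgebra_isAlgebra.Build F Q quot_scaleAr.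

End QuotientAlgebra.

Lemma malg_scaleAr (F : fieldType) (I : monomType) (a : F) (x y : {malg F[I]}) :
  a *: (x * y) = x * (a *: y).
Proof.
apply/malgP => k; rewrite mcoeffZ (mcoeffMlw (d1 := msupp x) (d2 := msupp y)) //.
rewrite (mcoeffMlw (d1 := msupp x) (d2 := msupp y)) ?msuppZ_le //.
rewrite mulr_sumr; apply: eq_bigr => k1 _; rewrite mulr_sumr.
by apply: eq_bigr => k2 _; rewrite mcoeffZ mulrnAr mulrCA.
Qed.

(* The free algebra on n ^ 2 generators, indexed by pairs (i, j). *)
Definition free_alg (F : fieldType) (n : nat) : Type :=
  {malg F[{fmonom ('I_n * 'I_n)%type}]}.

Section FreeAlgebra.
Variables (F : fieldType) (n : nat).

HB.instance Definition _ := GRing.Lalgebra.on (free_alg F n).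

Lemma free_scaleAr (a : F) (x y : free_alg F n) : a *: (x * y) = x * (a *: y).
Proof. exact: malg_scaleAr. Qed.

HB.instance Definition _ := GRing.Lalgebra_isAlgebra.Build F (free_alg F n)
  free_scaleAr.

Definition free_gen (i j : 'I_n) : free_alg F n := << fmu (i, j) >>.

(* Augmentation: the algebra map killing all generators. *)
Definition free_aug : free_alg F n -> F^o :=
  @mcoeff {fmonom ('I_n * 'I_n)%type} F (@mone _).

Lemma free_aug_gen i j : free_aug (free_gen i j) = 0.
Proof.
rewrite /free_aug /free_gen mcoeffU1; case: eqP => // /(congr1 (@fdeg _)).
by rewrite fdegU fdeg1.
Qed.

HB.instance Definition _ := GRing.RMorphism.copy free_aug free_aug.
HB.instance Definition _ := GRing.Linear.copy free_aug
  (free_aug : {linear {malg F[{fmonom ('I_n * 'I_n)%type}]} -> F^o}).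

End FreeAlgebra.

Section ReflectionEquationAlgebra.
Variables (F : fieldType) (n : nat).
Implicit Types (q : F) (R Psi : tmx F n 2).

Definition rea_relmx (A : algType F) R (L : 'M[A]_n) : tmx A n 2 :=
  let R12 : tmx A n 2 := map_mx (in_alg A) R in
  let L1 : tmx A n 2 := on_first 2 L in
  (R12 *m L1 *m R12 *m L1 - L1 *m R12 *m L1 *m R12) - (R12 *m L1 - L1 *m R12).

(* The quantum trace Tr (C X); Psi is the skew inverse that defines C. *)
Definition qtrace (A : algType F) Psi (X : 'M[A]_n) : A :=
  \tr (map_mx (in_alg A) (Cmx Psi) *m X).

Lemma rea_relmx0 (A : algType F) R : rea_relmx R (0 : 'M[A]_n) = 0.
Proof.
have first0 : on_first 2 (0 : 'M[A]_n) = 0.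
  by apply/matrixP=> I J; rewrite !mxE big_ord_recl /= !mxE mul0r.
by rewrite /rea_relmx first0 !(mulmx0, mul0mx, subr0).
Qed.

Lemma map_rea_relmx (A B : algType F) (f : {lrmorphism A -> B}) R
    (L : 'M[A]_n) : map_mx f (rea_relmx R L) = rea_relmx R (map_mx f L).
Proof.
have fR : map_mx f (map_mx (in_alg A) R) = map_mx (in_alg B) R.
  by apply/matrixP=> I J; rewrite !mxE rmorph_alg.
have fL : map_mx f (on_first 2 L) = on_first 2 (map_mx f L).
  apply/matrixP=> I J; rewrite !mxE rmorph_prod; apply: eq_bigr => a _.
  by case: ifP => _; rewrite ?mxE ?rmorph_nat.
by rewrite /rea_relmx !(map_mxB, map_mxM) fR fL.
Qed.

Definition rea_rel R (x : free_alg F n) : Prop :=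
  exists I J : {ffun 'I_2 -> 'I_n},
    x = tent (rea_relmx R (\matrix_(i, j) free_gen F i j)) I J.

Lemma rea_ideal_aug R x : ideal_gen (rea_rel R) x -> free_aug x = 0.
Proof.
elim=> {x} [_ [I [J ->]]||x y _ x0 _ y0|a x _ x0|a x _ x0].
- set L := (\matrix_(i, j) _).
  have L0 : map_mx (@free_aug F n) L = 0.
    by apply/matrixP=> i j; rewrite !mxE free_aug_gen.
  have := map_rea_relmx (@free_aug F n) R L.
  rewrite L0 rea_relmx0 => /matrixP/(_ (enum_rank I) (enum_rank J)).
  by rewrite [LHS]mxE [RHS]mxE.
- exact: rmorph0.
- by rewrite rmorphD /= x0 y0 addr0.
- by rewrite rmorphM /= x0 mulr0.
- by rewrite rmorphM /= x0 mul0r.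
Qed.

Lemma rea_proper R : ~ ideal_gen (rea_rel R) 1.
Proof. by move/rea_ideal_aug/eqP; rewrite rmorph1 oner_eq0. Qed.

Definition Lq R : algType F := quot_alg (@rea_proper R).

Definition lgen R (i j : 'I_n) : Lq R :=
  quot_proj (@rea_proper R) (free_gen F i j).

Definition Lqmx R : 'M[Lq R]_n := \matrix_(i, j) lgen R i j.

Definition sl_rel R Psi (x : Lq R) : Prop := x = qtrace Psi (Lqmx R).

Lemma aug_repr R (x : free_alg F n) :
  free_aug (quot_repr (quot_proj (@rea_proper R) x)) = free_aug x.
Proof.
by apply/eqP; rewrite -subr_eq0 -rmorphB; apply/eqP/rea_ideal_aug/quot_repr_proj.
Qed.

Lemma sl_proper R Psi : ~ ideal_gen (@sl_rel R Psi) 1.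
Proof.
pose aug (x : Lq R) := free_aug (quot_repr x).
have augM x y : aug (x * y) = aug x * aug y by rewrite /aug aug_repr rmorphM.
have augD x y : aug (x + y) = aug x + aug y.
  rewrite -[x]quot_reprK -[y]quot_reprK.
  by rewrite -(rmorphD (quot_proj (@rea_proper R))) /aug !aug_repr rmorphD.
have aug_gen i j : aug (lgen R i j) = 0.
  by rewrite /aug aug_repr free_aug_gen.
suff aug0 x : ideal_gen (@sl_rel R Psi) x -> aug x = 0.
  by move/aug0/eqP; rewrite /aug aug_repr rmorph1 oner_eq0.
have aug00 : aug 0 = 0 by apply: (addrI (aug 0)); rewrite -augD !addr0.
elim=> {x} [_ ->||x y _ x0 _ y0|a x _ x0|a x _ x0] //.
- rewrite /qtrace /mxtrace (big_morph aug augD aug00) big1 // => i _.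
  rewrite mxE (big_morph aug augD aug00) big1 // => j _.
  by rewrite [X in _ * X]mxE augM aug_gen mulr0.
- by rewrite augD x0 y0 addr0.
- by rewrite augM x0 mulr0.
- by rewrite augM x0 mul0r.
Qed.

Definition SLq R Psi : algType F := quot_alg (@sl_proper R Psi).

Definition fgen R Psi (i j : 'I_n) : SLq R Psi :=
  quot_proj (@sl_proper R Psi) (lgen R i j).

End ReflectionEquationAlgebra.

Section Representations.
Variable F : fieldType.

Record representation (A : algType F) (W : vectType F) := Representation {
  rep_act :> {linear A -> 'End(W)};
  rep_act1 : rep_act 1 = \1%VF;
  rep_actM : forall x y, rep_act (x * y) = (rep_act x \o rep_act y)%VF }.

Definition equivalent (A : algType F) (W W' : vectType F)
    (rho : representation A W) (rho' : representation A W') : Prop :=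
  exists2 phi : {linear W -> W'}, bijective phi &
    forall x w, phi (rho x w) = rho' x (phi w).

Variable n : nat.
Implicit Types (q : F) (R Psi : tmx F n 2).

Definition sl_reduction q R Psi (W : vectType F)
    (rho : representation (Lq R) W) (rhobar : representation (SLq R Psi) W) :
    Prop :=
  exists chi : F,
    let trC := \tr (Cmx Psi) in
    let omega := 1 - (q - q^-1) * chi / trC in
    [/\ rho (qtrace Psi (Lqmx R)) = chi *: \1%VF, omega != 0
      & forall i j, rhobar (fgen R Psi i j) =
          omega^-1 *: (rho (lgen R i j) - ((i == j)%:R * (chi / trC)) *: \1%VF)].

(* The k-th tensor power of V is the space of rows of coordinates in the basis
   (e_I), so X sends e_I to \sum_J X_I^J e_J exactly when it acts by
   v |-> v *m X.  For an operator, X is thus the transpose of its matrix. *)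
Definition antisym_space q R (k : nat) : {vspace 'rV[F]_#|{ffun 'I_k -> 'I_n}|} :=
  limg (linfun (mulmxr (antisym q R k))).

(* In the same convention, the operator e_k |-> B_k^j e_i. *)
Definition pi_t Psi (i j : 'I_n) : 'M[F]_n :=
  \matrix_(k, m) (Bmx Psi k j * (m == i)%:R).

Definition pi_antisym_t q R Psi (k : nat) (i j : 'I_n) : tmx F n k :=
  (q ^+ k.-1 * qnum q k) *:
    (antisym q R k *m on_first k (pi_t Psi i j) *m antisym q R k).

Definition is_pi_antisym q R Psi (k : nat)
    (rho : representation (Lq R) (subvs_of (antisym_space q R k))) : Prop :=
  forall i j w,
    vsval (rho (lgen R i j) w) = vsval w *m pi_antisym_t q R Psi k i j.

(* Up to sign, the matrix is R with the row index i and the column index j of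
   its second factor fixed. *)
Definition is_theta1 R (rho : representation (Lq R) 'cV[F]_n) : Prop :=
  forall i j (w : 'cV[F]_n),
    rho (lgen R i j) w =
      (\matrix_(a, b) - tent R [ffun c : 'I_2 => if c == ord0 then a else i]
                              [ffun c : 'I_2 => if c == ord0 then b else j]) *m w.

End Representations.

(* Main.v *)
Require Import Defs.
From HB Require Import structures.
From mathcomp Require Import all_boot all_order all_algebra ring.
From mathcomp Require Import complex reals.
From mathcomp Require Import monalg.

(** Write [A^(p) = u v] with a column [u] and a row [v], which is possible since
    its rank is one, and let [u_b] be the column in [p - 1] factors obtained
    from [u] by fixing its first index to [b].  The isomorphism from the image
    of [A^(p-1)] to the columns of size [n] is the contraction
    [x |-> (x u_b)_b].

    It intertwines the two representations up to an affine change: if [X] is the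
    operator of [l_i^j] on the antisymmetric space, then
    [(x X) u_b = q^-2 (q delta_i^j x u_b - sum_c R_(b i)^(c j) x u_c)], so
    that [pi(l_i^j)] corresponds to [q^-2 (q delta_i^j + theta(l_i^j))].  This is
    [intertwine_u].  Its source is the recursion defining [A^(p)], rewritten with
    the inverse of [R] as
    [q^p (p-1)_q A R_12^-1 A = q A - q^p p_q A^(p)], where [A] is [A^(p-1)] in the
    factors [2..p] ([antisym_rec_inv]).  One fixes the indices of the first factor,
    applies both sides to [u_b] and sums against [B_1 R_12].  On the left, the
    identity [Tr_1 B_1 R_12 X_2 R_12^-1 = Tr (B X) I] ([trB_conj], a consequence of
    the braid relation) turns [R^-1] into the B-type operator.  On the right, the
    pairings of the blocks of [v] and [u] form the matrix [C] up to a factor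
    ([rblk_cblk_C], from [A^(p+1) = 0]), and [C B = q^(-2p) I], so that the last
    term becomes [R].

    The contraction is bijective because the weighted trace of [A^(p)] writes
    [A^(p-1)] in terms of [u_b], of the blocks of [v] and of [B] ([trB_uv]), while
    the opposite composite is [C B].

    Finally, the reflection equation is preserved by [L |-> a L + b I] as soon as
    [a + lam b = 1] ([affine_theta_rea]), so the matrices of [pi] do define a
    representation, and its quantum trace acts as a scalar because it does so
    for [theta].  An sl-reduction selects, in such an affine family, the member of
    quantum trace zero; it is the same matrix for [theta] and for the transport of
    [pi].  The condition on [q] says that the normalizing factor is nonzero. *)

Set Implicit Arguments.
Unset Strict Implicit.
Unset Printing Implicit Defensive.

Import GRing.Theory.
Local Open Scope ring_scope.

(** * Blocks of an operator with respect to its first tensor factor *)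

Section Blocks.
Variables (A : nzRingType) (n : nat).

Definition tcons k (x : 'I_n) (I : {ffun 'I_k -> 'I_n}) := tinsert ord0 x I.
Definition ttail k (I : {ffun 'I_k.+1 -> 'I_n}) : {ffun 'I_k -> 'I_n} :=
  [ffun c => I (lift ord0 c)].

Lemma tcons0 k x (I : {ffun 'I_k -> 'I_n}) : tcons x I ord0 = x.
Proof. by rewrite ffunE unlift_none. Qed.

Lemma tconsS k x (I : {ffun 'I_k -> 'I_n}) c : tcons x I (lift ord0 c) = I c.
Proof. by rewrite ffunE liftK. Qed.

Lemma tconsK k (I : {ffun 'I_k.+1 -> 'I_n}) : tcons (I ord0) (ttail I) = I.
Proof.
apply/ffunP=> a; case: (unliftP ord0 a) => [c|] ->; last exact: tcons0.
by rewrite tconsS ffunE.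
Qed.

Lemma ttail_tcons k x (I : {ffun 'I_k -> 'I_n}) : ttail (tcons x I) = I.
Proof. by apply/ffunP=> c; rewrite ffunE tconsS. Qed.

Lemma tcons_eq k x y (I J : {ffun 'I_k -> 'I_n}) :
  (tcons x I == tcons y J) = (x == y) && (I == J).
Proof.
apply/eqP/andP=> [E|[/eqP-> /eqP->] //]; split; apply/eqP.
  by rewrite -(tcons0 x I) E tcons0.
by rewrite -(ttail_tcons x I) E ttail_tcons.
Qed.

Lemma big_tcons (T : nmodType) k (f : {ffun 'I_k.+1 -> 'I_n} -> T) :
  \sum_I f I = \sum_i \sum_I f (tcons i I).
Proof.
rewrite pair_big /= (reindex (fun u => tcons u.1 u.2)) //=.
exists (fun I : {ffun 'I_k.+1 -> 'I_n} => (I ord0, ttail I)) => [[i I]|I] _ /=.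
  by rewrite tcons0 ttail_tcons.
by rewrite tconsK.
Qed.

Lemma tent_tmk k (f : {ffun 'I_k -> 'I_n} -> {ffun 'I_k -> 'I_n} -> A) I J :
  tent (tmk f) I J = f I J.
Proof. by rewrite /tent /tmk mxE !enum_rankK. Qed.

Lemma tmxP k (X Y : tmx A n k) :
  (forall I J, tent X I J = tent Y I J) -> X = Y.
Proof.
move=> E; apply/matrixP=> a b.
by have := E (enum_val a) (enum_val b); rewrite /tent !enum_valK.
Qed.

Lemma tentD k (X Y : tmx A n k) I J : tent (X + Y) I J = tent X I J + tent Y I J.
Proof. by rewrite /tent mxE. Qed.

Lemma tentN k (X : tmx A n k) I J : tent (- X) I J = - tent X I J.
Proof. by rewrite /tent mxE. Qed.

Lemma tentZ k c (X : tmx A n k) I J : tent (c *: X) I J = c * tent X I J.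
Proof. by rewrite /tent mxE. Qed.

Lemma tentM k (X Y : tmx A n k) I J :
  tent (X *m Y) I J = \sum_K tent X I K * tent Y K J.
Proof.
rewrite /tent mxE (reindex (@enum_rank _)) //=.
by apply: onW_bij; apply: enum_rank_bij.
Qed.

Lemma tent_scalar k (c : A) I J :
  tent (c%:M : tmx A n k) I J = c *+ (I == J).
Proof. by rewrite /tent mxE (inj_eq enum_rank_inj). Qed.

Lemma tent_sum k (I : finType) (f : I -> tmx A n k) J K :
  tent (\sum_x f x) J K = \sum_x tent (f x) J K.
Proof.
apply: (big_morph (fun Z => tent Z J K)) => [X Y|]; first exact: tentD.
by rewrite /tent mxE.
Qed.

(** Operators on tensor powers are handled by peeling off the first factor:
    the blocks of a product multiply like matrix entries, so every identity
    below is checked on blocks or on scalars. *)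
Definition blk k (X : tmx A n k.+1) i j : tmx A n k :=
  tmk (fun I J => tent X (tcons i I) (tcons j J)).

Lemma tent_blk k (X : tmx A n k.+1) i j I J :
  tent (blk X i j) I J = tent X (tcons i I) (tcons j J).
Proof. exact: tent_tmk. Qed.

Lemma blkP k (X Y : tmx A n k.+1) : (forall i j, blk X i j = blk Y i j) -> X = Y.
Proof.
move=> E; apply: tmxP => I J; rewrite -[I]tconsK -[J]tconsK.
by rewrite -!tent_blk E.
Qed.

Lemma blkD k (X Y : tmx A n k.+1) i j : blk (X + Y) i j = blk X i j + blk Y i j.
Proof. by apply: tmxP => I J; rewrite !(tent_blk, tentD). Qed.

Lemma blkN k (X : tmx A n k.+1) i j : blk (- X) i j = - blk X i j.
Proof. by apply: tmxP => I J; rewrite !(tent_blk, tentN). Qed.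

Lemma blk_sum k (I : finType) (f : I -> tmx A n k.+1) i j :
  blk (\sum_x f x) i j = \sum_x blk (f x) i j.
Proof.
apply: tmxP => J K; rewrite tent_blk !tent_sum.
by apply: eq_bigr => x _; rewrite tent_blk.
Qed.

Lemma blkZ k c (X : tmx A n k.+1) i j : blk (c *: X) i j = c *: blk X i j.
Proof. by apply: tmxP => I J; rewrite !(tent_blk, tentZ). Qed.

Lemma blk_scalar k c i j :
  blk (c%:M : tmx A n k.+1) i j = (c *+ (i == j))%:M.
Proof.
apply: tmxP => I J; rewrite !(tent_blk, tent_scalar) tcons_eq.
by case: (i == j); case: (I == J).
Qed.

Lemma blkM k (X Y : tmx A n k.+1) i j :
  blk (X *m Y) i j = \sum_l blk X i l *m blk Y l j.
Proof.
apply: tmxP => I J; rewrite tent_blk tentM big_tcons.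
rewrite tent_sum; apply: eq_bigr => l _; rewrite tentM; apply: eq_bigr => K _.
by rewrite !tent_blk.
Qed.

Definition shift k (X : tmx A n k) : tmx A n k.+1 := emb (lift ord0) X.

Lemma blk_shift k (X : tmx A n k) i j : blk (shift X) i j = (i == j)%:R *: X.
Proof.
apply: tmxP => I J; rewrite tent_blk tent_tmk tentZ.
have -> : [forall a, (a \notin codom (lift (@ord0 k))) ==>
            (tcons i I a == tcons j J a)] = (i == j).
  apply/forallP/eqP=> [/(_ ord0)|-> a].
    rewrite !tcons0 => /implyP E; apply/eqP/E.
    by apply/negP=> /codomP[c] /eqP; rewrite eq_liftF.
  apply/implyP; case: (unliftP ord0 a) => [c|] ->.
    by rewrite codom_f.
  by rewrite !tcons0.
case: eqP => _; rewrite ?mul0r // mul1r.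
by congr tent; apply/ffunP=> c; rewrite ffunE tconsS.
Qed.

Lemma blk_mulshift k (X : tmx A n k.+1) Y i j :
  blk (X *m shift Y) i j = blk X i j *m Y.
Proof.
rewrite blkM (bigD1 j) //= blk_shift eqxx scale1r big1 ?addr0 //.
by move=> c /negPf; rewrite blk_shift => ->; rewrite scale0r mulmx0.
Qed.

Lemma blk_shiftmul k (X : tmx A n k.+1) Y i j :
  blk (shift Y *m X) i j = Y *m blk X i j.
Proof.
rewrite blkM (bigD1 i) //= blk_shift eqxx scale1r big1 ?addr0 //.
by move=> c /negPf; rewrite eq_sym blk_shift => ->; rewrite scale0r mul0mx.
Qed.

Definition pair2 (a i : 'I_n) : {ffun 'I_2 -> 'I_n} :=
  [ffun c => if c == ord0 then a else i].

Definition rent (R : tmx A n 2) a i b j : A := tent R (pair2 a i) (pair2 b j).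

Lemma pair2E a i (I : {ffun 'I_0 -> 'I_n}) : pair2 a i = tcons a (tcons i I).
Proof.
apply/ffunP=> c; case: (unliftP ord0 c) => [d|] ->; last by rewrite tcons0 ffunE.
rewrite tconsS ffunE eq_sym (negPf (neq_lift _ _)).
by rewrite (ord1 d) (_ : 0 = ord0) ?tcons0 //; apply: val_inj.
Qed.

Lemma blk2_at2 k (R : tmx A n 2) a b i j :
  blk (blk (at2 0 1 R : tmx A n k.+2) a b) i j = (rent R a i b j)%:M.
Proof.
apply: tmxP => I J; rewrite !tent_blk tent_tmk tent_scalar.
have E1 : 1 = lift ord0 ord0 :> 'I_k.+2 by apply: val_inj.
have E0 : 0 = ord0 :> 'I_k.+2 by apply: val_inj.
set s := fun c : 'I_2 => _.
have sP c : s (lift ord0 c) = 1 by [].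
have -> : [forall x, (x \notin codom s) ==>
   (tcons a (tcons i I) x == tcons b (tcons j J) x)] = (I == J).
  apply/forallP/eqP=> [E|-> x].
    apply/ffunP=> c; have /implyP := E (lift ord0 (lift ord0 c)).
    rewrite !tconsS => E'; apply/eqP/E'; apply/negP => /codomP[d].
    rewrite /s E0 E1; case: (d == _) => /eqP.
      by rewrite eq_sym eq_liftF.
    by rewrite (inj_eq (@lift_inj _ _)) eq_sym eq_liftF.
  apply/implyP; case: (unliftP ord0 x) => [y|] ->.
    case: (unliftP ord0 y) => [z|] -> ; rewrite !tconsS //.
    by rewrite -E1 -(sP ord0) codom_f.
  by rewrite -E0 -[0]/(s ord0) codom_f.
case: eqP => // _; rewrite /rent; congr tent; apply/ffunP=> c;
  rewrite [LHS]ffunE [RHS]ffunE /s.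
- by case: ifP => _; rewrite ?E0 ?tcons0 // E1 tconsS tcons0.
- by case: ifP => _; rewrite ?E0 ?tcons0 // E1 tconsS tcons0.
Qed.

End Blocks.

(** * Operators acting in chosen tensor factors *)

Section Embeddings.
Variables (A : nzRingType) (n : nat).

Definition agree_off m k (s : 'I_m -> 'I_k) (I J : {ffun 'I_k -> 'I_n}) :=
  [forall a, (a \notin codom s) ==> (I a == J a)].

Definition pull m k (s : 'I_m -> 'I_k) (I : {ffun 'I_k -> 'I_n}) :
  {ffun 'I_m -> 'I_n} := [ffun a => I (s a)].

Lemma tent_emb m k (s : 'I_m -> 'I_k) (X : tmx A n m) I J :
  tent (emb s X) I J =
    if agree_off s I J then tent X (pull s I) (pull s J) else 0.
Proof. exact: tent_tmk. Qed.

Lemma agree_offP m k (s : 'I_m -> 'I_k) (I J : {ffun 'I_k -> 'I_n}) :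
  reflect (forall a, a \notin codom s -> I a = J a) (agree_off s I J).
Proof.
apply: (iffP forallP) => [E a|E a]; first by move/(implyP (E a))/eqP.
by apply/implyP=> /E ->.
Qed.

Lemma agree_pull m k (s : 'I_m -> 'I_k) (I J : {ffun 'I_k -> 'I_n}) :
  agree_off s I J && (pull s I == pull s J) = (I == J).
Proof.
apply/andP/eqP=> [[/agree_offP E /eqP/ffunP Es]|->]; last first.
  by split=> //; apply/agree_offP.
apply/ffunP=> a; have [/codomP[c ->]|/E //] := boolP (a \in codom s).
by have := Es c; rewrite !ffunE.
Qed.

Lemma emb_scalar m k (s : 'I_m -> 'I_k) (c : A) :
  emb s (c%:M : tmx A n m) = c%:M.
Proof.
apply: tmxP => I J; rewrite tent_emb !tent_scalar -(agree_pull s).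
by case: ifP.
Qed.

Lemma embD m k (s : 'I_m -> 'I_k) (X Y : tmx A n m) :
  emb s (X + Y) = emb s X + emb s Y.
Proof.
apply: tmxP => I J; rewrite tentD !tent_emb tentD.
by case: ifP; rewrite ?addr0.
Qed.

Lemma embZ m k (s : 'I_m -> 'I_k) c (X : tmx A n m) :
  emb s (c *: X) = c *: emb s X.
Proof.
apply: tmxP => I J; rewrite tentZ !tent_emb tentZ.
by case: ifP; rewrite ?mulr0.
Qed.

Lemma embN m k (s : 'I_m -> 'I_k) (X : tmx A n m) : emb s (- X) = - emb s X.
Proof. by rewrite -scaleN1r embZ scaleN1r. Qed.

(** The sum over intermediate multi-indices collapses to those that agree with
    [I] outside the image of [s], and these are parametrized by their values on
    that image. *)
Lemma embM m k (s : 'I_m -> 'I_k) (X Y : tmx A n m) : injective s ->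
  emb s (X *m Y) = emb s X *m emb s Y.
Proof.
move=> inj_s; apply: tmxP => I J; rewrite tent_emb !tentM.
pose over (L : {ffun 'I_m -> 'I_n}) : {ffun 'I_k -> 'I_n} :=
  [ffun a => if [pick c | s c == a] is Some c then L c else I a].
have over_s L : pull s (over L) = L.
  apply/ffunP=> c; rewrite !ffunE; case: pickP => [d /eqP/inj_s -> //|].
  by move/(_ c); rewrite eqxx.
have over_off L : agree_off s I (over L).
  apply/agree_offP=> a Na; rewrite ffunE; case: pickP => // c /eqP Ec.
  by rewrite -Ec codom_f in Na.
rewrite [RHS](bigID (agree_off s I)) /= [X in _ + X]big1 ?addr0; last first.
  by move=> K /negPf E; rewrite tent_emb E mul0r.
rewrite (reindex_onto over (pull s)) => [|K /agree_offP E]; last first.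
  apply/ffunP=> a; rewrite !ffunE; case: pickP => [c /eqP <-|E'].
    by rewrite ffunE.
  by apply: E; apply/negP=> /codomP[c Ec]; have := E' c; rewrite Ec eqxx.
rewrite [RHS](eq_bigl xpredT) => [|L]; last by rewrite over_off over_s eqxx.
rewrite [RHS](eq_bigr (fun K => if agree_off s I J then
   tent X (pull s I) K * tent Y K (pull s J) else 0)) => [|K _].
  by case: ifP => [//|_]; rewrite big1.
rewrite !tent_emb over_off over_s.
have -> : agree_off s (over K) J = agree_off s I J.
  by apply: eq_forallb => a; case: (boolP (a \in _)) => //= Na;
     rewrite (agree_offP _ _ _ (over_off K)).
by case: ifP; rewrite ?mulr0.
Qed.

Lemma emb_comp l m k (s : 'I_m -> 'I_k) (t : 'I_l -> 'I_m) (X : tmx A n l) :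
  injective s -> emb s (emb t X) = emb (s \o t) X.
Proof.
move=> inj_s; apply: tmxP => I J; rewrite !tent_emb.
have pullE K : pull t (pull s K) = pull (s \o t) K :> {ffun _ -> 'I_n}.
  by apply/ffunP=> a; rewrite !ffunE.
have -> : agree_off (s \o t) I J =
    agree_off s I J && agree_off t (pull s I) (pull s J).
  apply/agree_offP/andP => [E|[/agree_offP Es /agree_offP Et] a Na].
    split; apply/agree_offP=> a Na.
      by apply: E; apply: contra Na => /codomP[c ->]; apply: codom_f.
    rewrite !ffunE; apply: E; apply: contra Na => /codomP[c /inj_s ->].
    exact: codom_f.
  have [/codomP[c Ec]|/Es //] := boolP (a \in codom s).
  have := Et c; rewrite !ffunE -Ec; apply; apply: contra Na => /codomP[d Ed].
  by rewrite Ec Ed; apply: (codom_f (s \o t)).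
by rewrite !pullE; case: (agree_off s I J).
Qed.

Lemma eq_emb m k (s t : 'I_m -> 'I_k) (X : tmx A n m) :
  s =1 t -> emb s X = emb t X.
Proof.
move=> E; apply: tmxP => I J; rewrite !tent_emb.
have pullE K : pull s K = pull t K :> {ffun _ -> 'I_n}.
  by apply/ffunP=> a; rewrite !ffunE E.
congr (if _ then _ else _); last by rewrite !pullE.
by apply: eq_forallb => a; rewrite (eq_codom E).
Qed.

Definition first2 k (X : tmx A n 2) : tmx A n k.+2 := at2 0 1 X.

Lemma first2_inj k :
  injective (fun c : 'I_2 => if c == ord0 then 0 else 1 : 'I_k.+2).
Proof.
move=> c d; case: (unliftP ord0 c) => [c'|] ->;
  case: (unliftP ord0 d) => [d'|] -> //=.
by rewrite (ord1 c') (ord1 d').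
Qed.

Lemma shift_first2 k X : shift (first2 k X) = at2 1 2 X.
Proof.
rewrite /shift /first2 /at2 emb_comp; last exact: lift_inj.
by apply: eq_emb => c /=; case: ifP => _; apply: val_inj.
Qed.

Lemma first2_id X : first2 0 X = X.
Proof.
apply: tmxP => I J; rewrite -[I]tconsK -[J]tconsK -!tent_blk.
rewrite -[ttail I]tconsK -[ttail J]tconsK -!tent_blk blk2_at2 tent_scalar.
rewrite tent_blk tent_blk.
have -> : (ttail (ttail I) == ttail (ttail J)) = true by apply/eqP/ffunP=> -[].
by rewrite /rent !(pair2E _ _ (ttail (ttail I))) mulr1n;
  congr tent; congr tcons; congr tcons; apply/ffunP=> -[].
Qed.

(** The braid relation is given in three factors; the inclusion of the first
    three factors transports it to any larger number of them. *)
Lemma widen3_inj k : injective (fun c : 'I_3 => inord c : 'I_k.+3).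
Proof.
move=> c d /(congr1 (@nat_of_ord _)); have ltk (e : 'I_3) : (e < k.+3)%N.
  exact: leq_trans (ltn_ord e) _.
by rewrite !inordK ?ltk // => /val_inj.
Qed.

Lemma widen3_first2 k X :
  emb (fun c : 'I_3 => inord c : 'I_k.+3) (first2 1 X) = first2 k.+1 X.
Proof.
rewrite /first2 /at2 emb_comp; last exact: widen3_inj.
by apply: eq_emb => c /=; case: ifP => _; apply: val_inj; rewrite /= inordK.
Qed.

Lemma widen3_shift_first2 k X :
  emb (fun c : 'I_3 => inord c : 'I_k.+3) (shift (first2 0 X)) =
  shift (first2 k X).
Proof.
rewrite !shift_first2 /at2 emb_comp; last exact: widen3_inj.
by apply: eq_emb => c /=; case: ifP => _; apply: val_inj; rewrite /= inordK.
Qed.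

Lemma shiftM k (X Y : tmx A n k) : shift (X *m Y) = shift X *m shift Y.
Proof. by apply: embM; apply: lift_inj. Qed.

Lemma first2M k (X Y : tmx A n 2) :
  first2 k (X *m Y) = first2 k X *m first2 k Y.
Proof. by apply: embM; apply: first2_inj. Qed.

End Embeddings.

Lemma first2_comm (F : fieldType) n k X (Y : tmx F n k) :
  first2 k X *m shift (shift Y) = shift (shift Y) *m first2 k X.
Proof.
apply: blkP => a b; apply: blkP => i j.
by rewrite !(blk_mulshift, blk_shiftmul, blk2_at2) scalar_mxC.
Qed.

(** * Idempotency of the antisymmetrizers *)

Section QuantumIntegers.
Variables (F : fieldType) (q : F).
Hypotheses (q0 : q != 0) (q_generic : forall k, (0 < k)%N -> q ^+ k != 1).

Lemma lambda_neq0 : q - q^-1 != 0.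
Proof.
apply: contra (q_generic (isT : 0 < 2)%N) => /eqP/(congr1 ( *%R q)).
by rewrite mulrBr mulfV // mulr0 expr2 => /eqP; rewrite subr_eq0.
Qed.

Lemma qnum0 : qnum q 0 = 0.
Proof. by rewrite /qnum expr0 invr1 subrr mul0r. Qed.

Lemma qnumS k : qnum q k.+1 = q^-1 * qnum q k + q ^+ k.
Proof.
rewrite /qnum exprS invfM.
have : q ^+ k != 0 by rewrite expf_neq0.
move: (q ^+ k) => x x0; field.
by rewrite x0 q0 /= andbT subr_eq0 -expr2 q_generic.
Qed.

Lemma qnum1 : qnum q 1 = 1.
Proof. by rewrite qnumS qnum0 mulr0 add0r. Qed.

Lemma qnum_neq0 k : qnum q k.+1 != 0.
Proof.
rewrite mulf_neq0 ?invr_eq0 ?lambda_neq0 // subr_eq0.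
apply: contra (q_generic (isT : 0 < k.+1 + k.+1)%N) => /eqP E.
by rewrite exprD {2}E mulfV // expf_neq0.
Qed.

Lemma qnumV k : (q - q^-1) * qnum q k = q ^+ k - q ^- k.
Proof. by rewrite mulrC divfK // lambda_neq0. Qed.

Lemma qnumS_inv k : qnum q k.+1 = q * qnum q k + q ^- k.
Proof.
have := qnumV k; rewrite mulrBl qnumS => E.
by rewrite -[q * _](subrK (q^-1 * qnum q k)) E addrAC subrK addrC.
Qed.

End QuantumIntegers.

(** One induction step, in abstract form: [a] and [b] stand for the
    antisymmetrizers in the factors [2..k+1] and [3..k+1], [Q] for [q ^ (k - 1)], and [n0], [n1]
    for the quantum integers [k - 1] and [k].  Up to normalization, [c] below
    is the antisymmetrizer in all the [k + 1] factors. *)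
Section HeckeStep.
Variables (F : fieldType) (N : nat) (q Q n0 n1 : F) (R1 R2 a b : 'M[F]_N).
Hypotheses (hecke1 : R1 *m R1 = (q - q^-1) *: R1 + 1%:M)
  (braid : R1 *m R2 *m R1 = R2 *m R1 *m R2)
  (aa : a *m a = a) (ab : a *m b = a) (bR1 : b *m R1 = R1 *m b)
  (a_rec : n1 *: a = Q *: b - n0 *: (b *m R2 *m b))
  (aR2 : a *m R2 = - q^-1 *: a).

(** Since [b] commutes with [R1], expanding the middle [a] by its recursion brings
    [R1 R2 R1] next to [a]; the braid relation moves [R2] to [a], where it is a
    scalar. *)
Lemma hecke_step_core :
  n1 *: (a *m R1 *m a *m R1) =
    Q *: a + (q * Q) *: (a *m R1) - (q^-1 * n1) *: (a *m R1 *m a).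
Proof.
have aR1b : a *m R1 *m b = a *m R1 by rewrite -mulmxA -bR1 mulmxA ab.
have E1 : n0 *: (a *m R1 *m R2 *m b) = Q *: (a *m R1) - n1 *: (a *m R1 *m a).
  rewrite [n1 *: _]scalemxAr a_rec mulmxBr -!scalemxAr aR1b !mulmxA aR1b.
  by rewrite opprB addrC subrK.
have E2 : n1 *: (a *m R1 *m a *m R1) =
    Q *: (a *m R1 *m R1) - n0 *: (a *m R1 *m R2 *m R1 *m b).
  rewrite scalemxAl [n1 *: _]scalemxAr a_rec mulmxBr mulmxBl -!scalemxAr.
  rewrite -!scalemxAl !mulmxA !aR1b; congr (_ - _ *: _).
  by rewrite -!mulmxA bR1.
have E3 : a *m R1 *m R2 *m R1 = - q^-1 *: (a *m R1 *m R2).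
  by rewrite -2!mulmxA (mulmxA R1) braid !mulmxA aR2 -!scalemxAl.
rewrite {}E2 {}E3 -scalemxAl scalerA [n0 * _]mulrC -[(- _ * n0) *: _]scalerA.
rewrite {}E1 -(mulmxA a) hecke1 mulmxDr mulmx1 -scalemxAr.
rewrite !scalerDr !scalerN !scalerA; apply/matrixP=> i j; rewrite !mxE.
by ring.
Qed.

Local Notation c := ((q * Q) *: a - n1 *: (a *m R1 *m a)).

Lemma hecke_step_eigen : q != 0 -> c *m R1 = - q^-1 *: c.
Proof.
move=> q0; rewrite mulmxBl -!scalemxAl hecke_step_core.
by apply/matrixP=> i j; rewrite !mxE; field.
Qed.

Lemma hecke_step_idem : q != 0 -> c *m c = (q^-1 * n1 + q * Q) *: c.
Proof.
move=> q0; have XX : n1 *: (a *m R1 *m a *m (a *m R1 *m a)) =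
    Q *: a + (q * Q - q^-1 * n1) *: (a *m R1 *m a).
  rewrite -!mulmxA (mulmxA a a) aa !mulmxA.
  rewrite scalemxAl hecke_step_core mulmxBl mulmxDl -!scalemxAl aa.
  rewrite -(mulmxA _ a a) aa; apply/matrixP=> i j; rewrite !mxE; ring.
have -> : c *m c = ((q * Q) ^+ 2) *: a - (2 * q * Q * n1) *: (a *m R1 *m a)
    + n1 *: (n1 *: (a *m R1 *m a *m (a *m R1 *m a))).
  rewrite mulmxBl !mulmxBr -!scalemxAl -!scalemxAr aa.
  rewrite -(mulmxA _ a a) aa !(mulmxA a) aa.
  by apply/matrixP=> i j; rewrite !mxE; ring.
by rewrite XX; apply/matrixP=> i j; rewrite !mxE; field.
Qed.

End HeckeStep.

Section Antisymmetrizers.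
Variables (F : fieldType) (n : nat) (q : F) (R : tmx F n 2).
Hypotheses (q0 : q != 0) (q_generic : forall k, (0 < k)%N -> q ^+ k != 1).
Hypotheses (R_YB : yang_baxter R) (R_hecke : hecke q R).

Local Notation asym := (antisym q R).
Local Notation R1 := (first2 _ R).

Lemma antisymE k : asym k.+2 = (qnum q k.+2)^-1 *:
  (shift (asym k.+1) *m ((q ^+ k.+1)%:M - qnum q k.+1 *: R1) *m
   shift (asym k.+1)).
Proof. reflexivity. Qed.

Lemma hecke_sqr : R *m R = (q - q^-1) *: R + 1%:M.
Proof.
rewrite -[LHS]subr0 -R_hecke mulmxBl !mulmxDr mul_mx_scalar mul_scalar_mx.
rewrite -scalar_mxM mulfV //; move: (R *m R) => RR.
by apply/matrixP=> i j; rewrite !mxE; ring.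
Qed.

Lemma first2_hecke k :
  first2 k R *m first2 k R = (q - q^-1) *: first2 k R + 1%:M.
Proof. by rewrite -first2M hecke_sqr /first2 /at2 embD embZ emb_scalar. Qed.

Lemma first2_braid k : first2 k.+1 R *m shift (first2 k R) *m first2 k.+1 R =
  shift (first2 k R) *m first2 k.+1 R *m shift (first2 k R).
Proof.
have inj := @widen3_inj k.
rewrite -widen3_first2 -widen3_shift_first2 -!embM //.
by congr emb; rewrite shift_first2; apply: R_YB.
Qed.

Let good k := [/\ asym k.+1 *m asym k.+1 = asym k.+1,
  asym k.+2 *m asym k.+2 = asym k.+2,
  asym k.+2 *m R1 = - q^-1 *: asym k.+2 & R1 *m asym k.+2 = - q^-1 *: asym k.+2].

Lemma antisym_rec k : asym k.+1 *m asym k.+1 = asym k.+1 ->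
  qnum q k.+2 *: asym k.+2 = q ^+ k.+1 *: shift (asym k.+1) -
    qnum q k.+1 *: (shift (asym k.+1) *m R1 *m shift (asym k.+1)).
Proof.
move=> idA; rewrite antisymE scalerA mulfV ?qnum_neq0 // scale1r.
rewrite mulmxBr mulmxBl mul_mx_scalar -!scalemxAr -!scalemxAl.
by rewrite -shiftM idA.
Qed.

Lemma antisym_shift k : asym k.+1 *m asym k.+1 = asym k.+1 ->
  asym k.+2 *m shift (asym k.+1) = asym k.+2 /\
  shift (asym k.+1) *m asym k.+2 = asym k.+2.
Proof.
move=> idA; rewrite antisymE; set s := shift _; set M := _ - _.
have ss : s *m s = s by rewrite -shiftM idA.
by rewrite -scalemxAl -scalemxAr -(mulmxA _ s s) ss !mulmxA ss.
Qed.

Let antisym_good k : good k.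
Proof.
elim: k => [|k [id1 id2 AR RA]].
  have A1 : asym 1 = 1%:M by [].
  have id1 : asym 1 *m asym 1 = asym 1 by rewrite A1 mulmx1.
  have s1 : shift (asym 1) = 1%:M by rewrite A1 /shift emb_scalar.
  have := antisym_rec id1; rewrite s1 mul1mx mulmx1 first2_id expr1 qnum1 //.
  rewrite scale1r => E.
  have u2 : qnum q 2 != 0 by apply: qnum_neq0.
  have n2 : qnum q 2 = q + q^-1 by rewrite qnumS // qnum1 // mulr1 expr1 addrC.
  rewrite /good; have {E} -> : asym 2 = (qnum q 2)^-1 *: (q *: 1%:M - R).
    by rewrite -E scalerA mulVf // scale1r.
  set X := _ - R; have XR : X *m R = - q^-1 *: X.
    rewrite mulmxBl -scalemxAl mul1mx hecke_sqr.
    by apply/matrixP => i j; rewrite !mxE; field.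
  have RX : R *m X = - q^-1 *: X.
    rewrite mulmxBr -scalemxAr mulmx1 hecke_sqr.
    by apply/matrixP => i j; rewrite !mxE; field.
  have XX : X *m X = qnum q 2 *: X.
    by rewrite {1}/X mulmxBl RX -scalemxAl mul1mx -scalerBl opprK n2.
  split=> //; rewrite ?first2_id -?scalemxAl -?scalemxAr.
  - by rewrite XX [_ *: (_ *: X)]scalerA mulVf // scale1r.
  - by rewrite XR scalerA mulrC -scalerA.
  - by rewrite RX scalerA mulrC -scalerA.
have [As sA] := antisym_shift id1.
have a_rec := antisym_rec id1; move/(congr1 (@shift _ _ _)): a_rec.
rewrite /shift embZ [in RHS]embD [in RHS]embN ![in RHS]embZ ![in RHS]embM;
  try exact: lift_inj.
rewrite -!/(shift _) => a_rec.
set a := shift (asym k.+2) in a_rec *.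
set b := shift (shift (asym k.+1)) in a_rec *.
set R2 := shift (first2 k R) in a_rec.
have [aa ab ba] : [/\ a *m a = a, a *m b = a & b *m a = a].
  by rewrite -!shiftM As sA id2.
have aR2 : a *m R2 = - q^-1 *: a by rewrite -shiftM AR /shift embZ.
have R2a : R2 *m a = - q^-1 *: a by rewrite -shiftM RA /shift embZ.
have bR : b *m R1 = R1 *m b by rewrite first2_comm.
have rec := antisym_rec id2; rewrite -/a [q ^+ k.+2]exprS in rec.
rewrite /good; have -> : asym k.+3 = (qnum q k.+3)^-1 *: ((q * q ^+ k.+1) *: a -
    qnum q k.+2 *: (a *m R1 *m a)).
  by rewrite -rec scalerA mulVf ?qnum_neq0 // scale1r.
have hsq := first2_hecke k.+1; have br := first2_braid k.
split=> //.
- rewrite -scalemxAl -scalemxAr (hecke_step_idem hsq br aa ab bR a_rec aR2) //.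
  rewrite -exprS -qnumS //; congr (_ *: _).
  by rewrite scalerA mulVf ?qnum_neq0 // scale1r.
- rewrite -scalemxAl (hecke_step_eigen hsq br ab bR a_rec aR2) //.
  by rewrite [LHS]scalerA [RHS]scalerA [_^-1 * _]mulrC.
  (* The hypotheses of the abstract step are invariant under transposition. *)
- rewrite -scalemxAr; set c := _ - _.
  have : c^T *m R1^T = - q^-1 *: c^T.
    rewrite /c linearB !linearZ /= scalerN !trmx_mul mulmxA.
    apply: (@hecke_step_eigen _ _ _ _ (qnum q k.+1) _ _ R2^T _ b^T) => //.
    + by rewrite -trmx_mul hsq linearD linearZ /= trmx1.
    + by rewrite -!trmx_mul !mulmxA br.
    + by rewrite -trmx_mul ba.
    + by rewrite -!trmx_mul bR.
    + rewrite -linearZ /= a_rec linearB !linearZ /= scalerN !trmx_mul.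
      by rewrite mulmxA scalerN.
    + by rewrite -trmx_mul R2a linearZ.
  rewrite -trmx_mul -linearZ => /trmx_inj ->.
  by rewrite [LHS]scalerA [RHS]scalerA [_^-1 * _]mulrC.
Qed.

Lemma antisym_idem k : asym k.+1 *m asym k.+1 = asym k.+1.
Proof. by case: (antisym_good k). Qed.

End Antisymmetrizers.

(** * Partial traces and the skew inverse *)

Section WeightedTrace.
Variables (F : fieldType) (n : nat) (B : 'M[F]_n).

Definition wtrace k (X : tmx F n k.+1) : tmx F n k :=
  \sum_a \sum_b B a b *: blk X b a.

Lemma wtraceD k (X Y : tmx F n k.+1) : wtrace (X + Y) = wtrace X + wtrace Y.
Proof.
rewrite -big_split; apply: eq_bigr => a _; rewrite -big_split.
by apply: eq_bigr => b _; rewrite blkD scalerDr.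
Qed.

Lemma wtraceZ k c (X : tmx F n k.+1) : wtrace (c *: X) = c *: wtrace X.
Proof.
rewrite scaler_sumr; apply: eq_bigr => a _; rewrite scaler_sumr.
by apply: eq_bigr => b _; rewrite blkZ !scalerA mulrC.
Qed.

Lemma wtrace_shiftmul k (X : tmx F n k.+1) Y :
  wtrace (shift Y *m X) = Y *m wtrace X.
Proof.
rewrite mulmx_sumr; apply: eq_bigr => a _; rewrite mulmx_sumr.
by apply: eq_bigr => b _; rewrite blk_shiftmul scalemxAr.
Qed.

Lemma wtrace_mulshift k (X : tmx F n k.+1) Y :
  wtrace (X *m shift Y) = wtrace X *m Y.
Proof.
rewrite mulmx_suml; apply: eq_bigr => a _; rewrite mulmx_suml.
by apply: eq_bigr => b _; rewrite blk_mulshift scalemxAl.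
Qed.

Lemma wtrace_scalar k c : wtrace (c%:M : tmx F n k.+1) = (\tr B * c)%:M.
Proof.
rewrite /mxtrace mulr_suml raddf_sum; apply: eq_bigr => a _ /=.
rewrite (bigD1 a) //= big1 ?addr0 => [|b /negPf ba].
  by rewrite blk_scalar eqxx scale_scalar_mx.
by rewrite blk_scalar ba mulr0n raddf0 scaler0.
Qed.

(** The hypothesis is [Tr_1 B_1 X_12 = I], entry by entry. *)
Lemma wtrace_first2 k (X : tmx F n 2) :
  (forall i j, \sum_a \sum_b B a b * rent X b i a j = (i == j)%:R) ->
  wtrace (first2 k X) = 1%:M.
Proof.
move=> trX; apply: blkP => i j; rewrite blk_scalar -[1 *+ _]trX.
rewrite blk_sum raddf_sum; apply: eq_bigr => a _.
rewrite blk_sum raddf_sum; apply: eq_bigr => b _ /=.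
by rewrite blkZ blk2_at2 scale_scalar_mx.
Qed.

End WeightedTrace.

Section SkewInverse.
Variables (F : fieldType) (n : nat) (R Psi : tmx F n 2).
Hypothesis skew : skew_inverse R Psi.

Lemma ptr_first2_shift (X Y : tmx F n 2) k x l y :
  tent (ptr 1 (at2 0 1 X *m at2 1 2 Y : tmx F n 3)) (pair2 k x) (pair2 l y) =
  \sum_s \sum_t rent X k s l t * rent Y t x s y.
Proof.
pose e : {ffun 'I_0 -> 'I_n} := [ffun c : 'I_0 => k].
have ins s a b : tinsert 1 s (pair2 a b) = tcons a (tcons s (tcons b e)).
  apply/ffunP=> c; rewrite ffunE; case: unliftP => [d ->|->].
    case: (unliftP ord0 d) => [d'|] ->; rewrite ffunE /=.
      rewrite (ord1 d') /= (_ : lift _ _ = lift ord0 (lift ord0 ord0)).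
        by rewrite !tconsS tcons0.
      exact: val_inj.
    by rewrite (_ : lift _ _ = ord0) ?tcons0 //; apply: val_inj.
  by rewrite (_ : 1 = lift ord0 ord0) ?tconsS ?tcons0 //; apply: val_inj.
rewrite tent_tmk; apply: eq_bigr => s _; rewrite !ins -shift_first2 -!tent_blk.
rewrite blk_mulshift blkM tent_blk.
rewrite tent_sum; apply: eq_bigr => t _.
rewrite blk2_at2 mul_scalar_mx tentZ first2_id tent_blk.
by rewrite /rent !(pair2E _ _ e).
Qed.

Lemma tent_flip k x l y :
  tent (flip F n) (pair2 k x) (pair2 l y) = ((k == y) && (x == l))%:R.
Proof. by rewrite tent_tmk !ffunE. Qed.

Lemma skewl k x l y :
  \sum_s \sum_t rent R k s l t * rent Psi t x s y = ((k == y) && (x == l))%:R.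
Proof. by rewrite -ptr_first2_shift (proj1 skew) tent_flip. Qed.

Lemma skewr k x l y :
  \sum_s \sum_t rent Psi k s l t * rent R t x s y = ((k == y) && (x == l))%:R.
Proof. by rewrite -ptr_first2_shift -(proj2 skew) tent_flip. Qed.

Lemma tinsert1_pair x i :
  tinsert (1 : 'I_2) x [ffun=> i] = pair2 i x :> {ffun _ -> 'I_n}.
Proof.
apply/ffunP=> c; rewrite ffunE; case: unliftP => [d ->|->]; rewrite !ffunE //.
by rewrite (ord1 d).
Qed.

Lemma CmxE i j : Cmx Psi i j = \sum_x rent Psi i x j x.
Proof.
by rewrite mxE tent_tmk; apply: eq_bigr => x _; rewrite !tinsert1_pair.
Qed.

Lemma BmxE i j : Bmx Psi i j = \sum_x rent Psi x i x j.
Proof.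
rewrite mxE tent_tmk; apply: eq_bigr => x _; rewrite !tinsert1_pair.
rewrite tent_tmk.
have -> : [forall a,
    (a \notin codom (fun c : 'I_2 => if c == ord0 then 1 else 0 : 'I_2)) ==>
    (pair2 i x a == pair2 j x a)] = true.
  apply/forallP=> a; apply/implyP=> /negP[]; apply/codomP.
  case: (unliftP ord0 a) => [d|] ->; last by exists 1; apply: val_inj.
  by exists ord0; rewrite (ord1 d); apply: val_inj.
rewrite /rent; congr tent; apply/ffunP=> c; rewrite !ffunE.
  by case: (c == ord0).
by case: (c == ord0).
Qed.

Local Notation B := (Bmx Psi).
Local Notation C := (Cmx Psi).

Lemma tr_BC : \tr B = \tr C.
Proof.
rewrite /mxtrace; under eq_bigr do rewrite BmxE.
by rewrite exchange_big; apply: eq_bigr => x _; rewrite CmxE.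
Qed.

(** The second skew-inverse identity, traced once more. *)
Lemma trB_R i j : \sum_a \sum_b B a b * rent R b i a j = (i == j)%:R.
Proof.
transitivity (\sum_x \sum_a \sum_b rent Psi x a x b * rent R b i a j).
  rewrite [RHS]exchange_big; apply: eq_bigr => a _ /=.
  rewrite [RHS]exchange_big; apply: eq_bigr => b _ /=.
  by rewrite BmxE mulr_suml.
under eq_bigr do rewrite skewr.
rewrite (bigD1 i) //= eqxx andbT big1 ?addr0 // => x /negPf.
by rewrite eq_sym => ->; rewrite andbF.
Qed.

(** The first skew-inverse identity, traced once more. *)
Lemma trC_R k l : \sum_s \sum_t rent R k s l t * C t s = (k == l)%:R.
Proof.
transitivity (\sum_x \sum_s \sum_t rent R k s l t * rent Psi t x s x).
  rewrite [RHS]exchange_big; apply: eq_bigr => a _ /=.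
  rewrite [RHS]exchange_big; apply: eq_bigr => b _ /=.
  by rewrite CmxE mulr_sumr.
under eq_bigr do rewrite skewl.
rewrite (bigD1 k) //= eqxx /= big1 ?addr0 // => x /negPf.
by rewrite eq_sym => ->.
Qed.

(** Skew-invertibility makes [Z |-> Tr_2 R_12 Z_2] injective, and by [trC_R] the
    matrix [C] is sent to the identity. *)
Lemma skew_inj (Z : 'M[F]_n) c :
  (forall k l, \sum_s \sum_t rent R k s l t * Z t s = c * (k == l)%:R) ->
  Z = c *: C.
Proof.
move=> E; apply/matrixP=> a b; rewrite mxE CmxE mulr_sumr.
transitivity (\sum_x \sum_z rent Psi a x b z * (c * (z == x)%:R)); last first.
  apply: eq_bigr => x _; rewrite (bigD1 x) //= eqxx big1 ?addr0 => [|z /negPf ->].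
    by rewrite mulr1 mulrC.
  by rewrite !mulr0.
under eq_bigr => x _.
  under eq_bigr => z _.
    rewrite -E mulr_sumr.
    under eq_bigr do rewrite mulr_sumr.
    over.
  rewrite exchange_big; under eq_bigr do rewrite exchange_big.
  over.
rewrite exchange_big; under eq_bigr do rewrite exchange_big.
transitivity (\sum_s \sum_t ((a == t) && (s == b))%:R * Z t s).
  rewrite (bigD1 b) //= [X in _ + X]big1 ?addr0 => [|s /negPf sb].
    rewrite (bigD1 a) //= !eqxx mul1r big1 ?addr0 // => t /negPf.
    by rewrite eq_sym => ->; rewrite mul0r.
  by rewrite big1 // => t _; rewrite sb andbF mul0r.
apply: eq_bigr => s _; apply: eq_bigr => t _ /=; rewrite -skewr mulr_suml.
by apply: eq_bigr => x _; rewrite mulr_suml; apply: eq_bigr => z _; rewrite mulrA.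
Qed.

End SkewInverse.

(** * Consequences of the braid and Hecke relations for B and C *)

Section HeckeRMatrix.
Variables (F : fieldType) (n : nat) (q : F) (R Psi : tmx F n 2).
Hypotheses (q0 : q != 0) (q_generic : forall k, (0 < k)%N -> q ^+ k != 1).
Hypotheses (R_YB : yang_baxter R) (R_hecke : hecke q R).
Hypothesis (skew : skew_inverse R Psi).

Local Notation asym := (antisym q R).
Local Notation B := (Bmx Psi).
Local Notation C := (Cmx Psi).
Local Notation lam := (q - q^-1).
Local Notation r := (rent R).

(** The inverse of [R], by the Hecke relation. *)
Definition invR : tmx F n 2 := R - lam%:M.
Local Notation ri := (rent invR).

Lemma invRE a i b j : ri a i b j = r a i b j - lam * ((a == b) && (i == j))%:R.
Proof.
rewrite /rent tentD tentN tent_scalar mulr_natr.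
pose e : {ffun 'I_0 -> 'I_n} := [ffun=> a].
by rewrite !(pair2E _ _ e) !tcons_eq eqxx andbT.
Qed.

Lemma first2_invR k : first2 k invR = first2 k R - lam%:M.
Proof. by rewrite /first2 /at2 embD embN emb_scalar. Qed.

Lemma first2V k : first2 k R *m first2 k invR = 1%:M.
Proof.
rewrite first2_invR mulmxBr (first2_hecke q0 R_hecke) mul_mx_scalar.
by rewrite addrAC subrr add0r.
Qed.

Lemma first2Vl k : first2 k invR *m first2 k R = 1%:M.
Proof. by apply: mulmx1C; apply: first2V. Qed.

Lemma braid_inv : first2 1 R *m shift (first2 0 R) *m first2 1 invR =
  shift (first2 0 invR) *m first2 1 R *m shift (first2 0 R).
Proof.
set R1 := first2 1 R; set R2 := shift _.
set R1i := first2 1 _; set R2i := shift _.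
have R2V : R2i *m R2 = 1%:M by rewrite -shiftM first2Vl /shift emb_scalar.
have E : R2 *m (R1 *m R2 *m R1i) = R1 *m R2.
  by rewrite !mulmxA -[R2 *m R1 *m R2]first2_braid // -mulmxA first2V mulmx1.
by rewrite -[LHS]mul1mx -R2V -mulmxA E mulmxA.
Qed.

Let pull_sum (I J K : finType) (g : I -> J -> K -> F) w :
  \sum_s \sum_t (\sum_a g a s t) * w s t = \sum_a \sum_s \sum_t g a s t * w s t.
Proof.
rewrite [RHS]exchange_big; apply: eq_bigr => s _; rewrite [RHS]exchange_big.
by apply: eq_bigr => t _; rewrite mulr_suml.
Qed.

(** Entrywise form of [Tr_1 B_1 R_12 X_2 R_12^-1 = Tr (B X) I].  For
    [X_2 = Tr_3 (R_23 Y_3)] it is the weighted trace of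
    [R_12 R_23 R_12^-1 = R_23^-1 R_12 R_23], and every [X] has this form because
    [R] is skew-invertible. *)
Lemma trB_conj x y i j :
  \sum_a \sum_b \sum_c B a b * r b i c y * ri c x a j = B x y * (i == j)%:R.
Proof.
have tr1 s t : \sum_a \sum_b B a b * (\sum_c \sum_k \sum_l
    r b i c k * r k s l t * ri c l a j) = (i == j)%:R * (s == t)%:R.
  pose e : {ffun 'I_0 -> 'I_n} := [ffun=> i].
  have := congr1 (@wtrace _ _ B 2) braid_inv.
  rewrite wtrace_mulshift wtrace_shiftmul (wtrace_first2 _ (trB_R skew)).
  rewrite mulmx1 first2Vl.
  move/(congr1 (fun Z => tent (blk Z i j) (tcons s e) (tcons t e))).
  rewrite blk_scalar tent_scalar tcons_eq eqxx andbT => E.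
  have -> : (i == j)%:R * (s == t)%:R = 1 *+ (i == j) *+ (s == t) :> F.
    by case: (i == j); case: (s == t); rewrite /= ?mulr1 ?mulr0.
  rewrite -E /wtrace.
  rewrite blk_sum tent_sum; apply: eq_bigr => a _.
  rewrite blk_sum tent_sum; apply: eq_bigr => b _.
  rewrite !blkZ tentZ; congr (_ * _).
  rewrite blkM blk_sum tent_sum; apply: eq_bigr => c _.
  rewrite blk_mulshift -mulmxA !blkM tent_sum; apply: eq_bigr => k _.
  rewrite blk2_at2 mul_scalar_mx blkM tentZ tent_sum mulr_sumr.
  apply: eq_bigr => l _; rewrite blk2_at2 mul_mx_scalar tentZ mulrCA mulrC.
  by rewrite tent_blk first2_id /rent !(pair2E _ _ e).
transitivity (\sum_s \sum_t ((i == j)%:R * (s == t)%:R) * rent Psi t x s y).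
  under [RHS]eq_bigr => s _ do under eq_bigr => t _ do rewrite -tr1.
  rewrite pull_sum; apply: eq_bigr => a _; rewrite pull_sum.
  apply: eq_bigr => b _; under [RHS]eq_bigr => s _ do
    under eq_bigr => t _ do rewrite mulr_sumr.
  rewrite pull_sum; apply: eq_bigr => c _; under [RHS]eq_bigr => s _ do
    under eq_bigr => t _ do rewrite mulr_sumr.
  rewrite pull_sum.
  transitivity (\sum_k \sum_l B a b * r b i c k *
    ((k == y) && (x == l))%:R * ri c l a j).
    rewrite (bigD1 y) //= [X in _ + X]big1 ?addr0 => [|k /negPf ->]; last first.
      by rewrite big1 // => l _; rewrite mulr0 mul0r.
    rewrite (bigD1 x) //= !eqxx mulr1 big1 ?addr0 // => l /negPf.
    by rewrite eq_sym => ->; rewrite mulr0 mul0r.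
  apply: eq_bigr => k _; under [RHS]eq_bigr => s _ do
    under eq_bigr => t _ do rewrite mulr_sumr.
  rewrite pull_sum; apply: eq_bigr => l _; rewrite -(skewl skew).
  rewrite mulr_sumr mulr_suml; apply: eq_bigr => s _.
  by rewrite mulr_sumr mulr_suml; apply: eq_bigr => t _; ring.
rewrite BmxE mulr_suml; apply: eq_bigr => s _.
rewrite (bigD1 s) //= eqxx big1 ?addr0 => [|t /negPf].
  by rewrite mulr1 mulrC.
by rewrite eq_sym => ->; rewrite mulr0 mul0r.
Qed.

(** Contracting [trB_conj] with [C] cancels one [R] by [trC_R] and leaves
    [Tr_1 B_1 R_12^-1], which the Hecke relation evaluates. *)
Lemma BC_scalar : B *m C = (1 - lam * \tr B)%:M.
Proof.
apply/matrixP=> x j; rewrite !mxE.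
transitivity (\sum_i \sum_y
    (\sum_a \sum_b \sum_c B a b * r b i c y * ri c x a j) * C y i).
  under [RHS]eq_bigr do under eq_bigr do rewrite trB_conj.
  rewrite exchange_big; apply: eq_bigr => y _; rewrite (bigD1 j) //= big1 ?addr0.
    by rewrite eqxx mulr1.
  by move=> i /negPf ij; rewrite ij mulr0 mul0r.
transitivity (\sum_a \sum_b B a b * ri b x a j).
  rewrite pull_sum; apply: eq_bigr => a _; rewrite pull_sum.
  apply: eq_bigr => b _; rewrite pull_sum.
  transitivity (\sum_c B a b * (b == c)%:R * ri c x a j).
    apply: eq_bigr => c _; rewrite -(trC_R skew).
    rewrite mulr_sumr mulr_suml; apply: eq_bigr => s _.
    by rewrite mulr_sumr mulr_suml; apply: eq_bigr => t _; ring.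
  rewrite (bigD1 b) //= eqxx mulr1 big1 ?addr0 // => c /negPf.
  by rewrite eq_sym => ->; rewrite mulr0 mul0r.
transitivity (\sum_a \sum_b B a b * r b x a j - lam * (x == j)%:R * \tr B).
  rewrite /mxtrace mulr_sumr -sumrB; apply: eq_bigr => a _.
  transitivity (\sum_b (B a b * r b x a j -
      lam * (x == j)%:R * B a b * (b == a)%:R)).
    by apply: eq_bigr => b _; rewrite invRE -mulnb natrM; ring.
  rewrite sumrB; congr (_ - _); rewrite (bigD1 a) //= eqxx mulr1 big1 ?addr0 //.
  by move=> b /negPf ->; rewrite mulr0.
by rewrite (trB_R skew) -mulr_natr; ring.
Qed.

(** The weighted trace of the recursion turns the last antisymmetrizer into a
    multiple of the previous one, and this multiple has to vanish. *)
Lemma trB_of_antisym0 m : asym m.+1 != 0 -> asym m.+2 = 0 ->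
  \tr B = q ^- m.+1 * qnum q m.+1.
Proof.
move=> A0 /(congr1 ( *:%R (qnum q m.+2))).
have idA := antisym_idem q0 q_generic R_YB R_hecke m.
rewrite scaler0 antisym_rec // => /(congr1 (@wtrace _ _ B _)).
rewrite wtraceD -scaleNr !wtraceZ wtrace_mulshift wtrace_shiftmul.
rewrite (wtrace_first2 _ (trB_R skew)) mulmx1 idA.
rewrite -[shift _]mul1mx wtrace_mulshift wtrace_scalar mulr1 mul_scalar_mx.
rewrite scalerA scaleNr -scalerBl -(scale0r 0) wtraceZ scale0r => /eqP.
rewrite scaler_eq0 (negPf A0) orbF subr_eq0 => /eqP <-.
by rewrite mulrA mulVf ?mul1r // expf_neq0.
Qed.

End HeckeRMatrix.

(** * The rank-one antisymmetrizer and the intertwining identity *)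

Section VectorBlocks.
Variables (F : fieldType) (n : nat).
Local Notation dim k := #|{ffun 'I_k -> 'I_n}|.

Definition cblk k (w : 'cV[F]_(dim k.+1)) b : 'cV[F]_(dim k) :=
  \col_a w (enum_rank (tcons b (enum_val a))) 0.

Definition rblk k (w : 'rV[F]_(dim k.+1)) l : 'rV[F]_(dim k) :=
  \row_a w 0 (enum_rank (tcons l (enum_val a))).

Lemma sum_dim k (f : 'I_(dim k) -> F) :
  \sum_a f a = \sum_(I : {ffun 'I_k -> 'I_n}) f (enum_rank I).
Proof.
by rewrite (reindex (@enum_rank _)) //=; apply: onW_bij; apply: enum_rank_bij.
Qed.

Lemma blk_outer k (u : 'cV[F]_(dim k.+1)) (v : 'rV_(dim k.+1)) b l :
  blk (u *m v) b l = cblk u b *m rblk v l.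
Proof.
by apply/matrixP=> a c; rewrite mxE /tent !mxE !big_ord1 !mxE.
Qed.

Lemma cblkM k (X : tmx F n k.+1) w b :
  cblk (X *m w) b = \sum_c blk X b c *m cblk w c.
Proof.
apply/colP=> a; rewrite mxE mxE sum_dim big_tcons summxE.
apply: eq_bigr => c _; rewrite mxE sum_dim; apply: eq_bigr => I _.
by rewrite !mxE /tent !enum_rankK.
Qed.

Lemma row_colM k (v : 'rV[F]_(dim k.+1)) w :
  v *m w = \sum_c rblk v c *m cblk w c.
Proof.
apply/matrixP=> i j; rewrite !ord1 mxE sum_dim big_tcons summxE.
apply: eq_bigr => c _; rewrite mxE sum_dim; apply: eq_bigr => I _.
by rewrite !mxE !enum_rankK.
Qed.

Lemma cblk_shiftM k (Y : tmx F n k) w b : cblk (shift Y *m w) b = Y *m cblk w b.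
Proof.
rewrite cblkM (bigD1 b) //= blk_shift eqxx scale1r big1 ?addr0 // => c.
by rewrite eq_sym => /negPf E; rewrite blk_shift E scale0r mul0mx.
Qed.

End VectorBlocks.

Lemma blk_on_first (A : nzRingType) n k (X : 'M[A]_n) i j :
  blk (on_first k.+1 X) i j = (X i j)%:M.
Proof.
apply: tmxP => I J; rewrite tent_blk tent_tmk big_ord_recl /= !tcons0 tent_scalar.
rewrite (eq_bigr (fun a => (I a == J a)%:R)) => [|a _]; last by rewrite !tconsS.
have [->|neqIJ] := eqVneq I J.
  by rewrite big1 ?mulr1 // => a _; rewrite eqxx.
have [a /negPf Ea] : exists a, I a != J a.
  apply/existsP; rewrite -negb_forall; apply: contra neqIJ => /forallP E.
  by apply/eqP/ffunP=> a; apply/eqP.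
rewrite mulr0n; have -> : \prod_a (I a == J a)%:R = 0 :> A.
  have : a \in index_enum 'I_k by rewrite mem_index_enum.
  elim: (index_enum _) => // c s IHs; rewrite inE big_cons.
  by case: eqP => [<- _|_ /IHs ->]; rewrite ?Ea ?mul0r ?mulr0.
by rewrite mulr0.
Qed.

Section RankOne.
Variables (F : fieldType) (n : nat) (q : F) (R Psi : tmx F n 2).
Hypotheses (q0 : q != 0) (q_generic : forall k, (0 < k)%N -> q ^+ k != 1).
Hypotheses (R_YB : yang_baxter R) (R_hecke : hecke q R).
Hypothesis (skew : skew_inverse R Psi).

Local Notation asym := (antisym q R).
Local Notation B := (Bmx Psi).
Local Notation C := (Cmx Psi).
Local Notation lam := (q - q^-1).
Local Notation r := (rent R).
Local Notation ri := (rent (invR q R)).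

(** By [trB_conj], the weight [B R] turns the blocks of the inverse of [R] into
    the operators of the B-type representation. *)
Lemma weighted_invR k i j :
  \sum_x \sum_z (\sum_a B z a * r a i x j) *: blk (first2 k (invR q R)) x z =
  on_first k.+1 (pi_t Psi i j).
Proof.
apply: blkP => c l; rewrite blk_on_first mxE blk_sum.
have -> : B c j * (l == i)%:R =
    \sum_x \sum_z \sum_a B z a * r a i x j * ri x c z l.
  rewrite eq_sym -(trB_conj q0 R_YB R_hecke skew) [RHS]exchange_big.
  by apply: eq_bigr => z _; rewrite exchange_big.
rewrite raddf_sum; apply: eq_bigr => x _ /=.
rewrite blk_sum raddf_sum; apply: eq_bigr => z _ /=.
by rewrite blkZ blk2_at2 scale_scalar_mx mulr_suml.
Qed.

(** The recursion defining the antisymmetrizers, with [R] traded for its inverse: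
    the coefficient [q ^ k - lam k_q] becomes [q ^ (- k)]. *)
Lemma antisym_rec_inv m :
  q ^+ m.+2 * qnum q m.+1 *:
    (shift (asym m.+1) *m first2 m (invR q R) *m shift (asym m.+1)) =
  q *: shift (asym m.+1) - q ^+ m.+2 * qnum q m.+2 *: asym m.+2.
Proof.
have idA := antisym_idem q0 q_generic R_YB R_hecke m.
rewrite -[X in _ = _ - X]scalerA antisym_rec // first2_invR mulmxBr mulmxBl.
rewrite mul_mx_scalar -scalemxAl -shiftM idA.
have lamk := qnumV q0 q_generic m.+1.
set s := shift _; set X := _ *m s; apply/matrixP=> a b; rewrite !mxE.
move: (s a b) (X a b) => sab Xab.
rewrite -[q ^+ m.+2 * _ * _]mulrA mulrBr [qnum q m.+1 * (lam * _)]mulrA.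
rewrite [qnum _ _ * lam]mulrC lamk.
rewrite exprS; move: (qnum q m.+1) => nm; field.
by rewrite expf_neq0.
Qed.

Variable m : nat.
Local Notation p := m.+2.
Variables (u : 'cV[F]_#|{ffun 'I_p -> 'I_n}|).
Variables (v : 'rV[F]_#|{ffun 'I_p -> 'I_n}|).
Hypotheses (Ap_uv : asym p = u *m v) (Ap0 : asym p != 0) (Ap1 : asym p.+1 = 0).

Local Notation u_ := (cblk u).
Local Notation v_ := (rblk v).
Local Notation A := (asym m.+1).

Let idA k : asym k.+1 *m asym k.+1 = asym k.+1.
Proof. exact: antisym_idem. Qed.

Lemma rank1_pairing : v *m u = 1%:M.
Proof.
have := idA m.+1; rewrite Ap_uv -mulmxA (mulmxA v) [v *m u]mx11_scalar.
rewrite mul_scalar_mx -scalemxAr -Ap_uv => /eqP.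
rewrite -subr_eq0 -{2}[asym p]scale1r -scalerBl scaler_eq0 (negPf Ap0) orbF.
by rewrite subr_eq0 => /eqP ->.
Qed.

Lemma shift_antisym_u : shift A *m u = u.
Proof.
have <- : asym p *m u = u by rewrite Ap_uv -mulmxA rank1_pairing mulmx1.
by rewrite mulmxA (proj2 (antisym_shift (idA m))).
Qed.

Lemma antisym_cblk b : A *m u_ b = u_ b.
Proof. by rewrite -cblk_shiftM shift_antisym_u. Qed.

Lemma trB_rank : \tr B = q ^- p * qnum q p.
Proof. exact: trB_of_antisym0 Ap0 Ap1. Qed.

(** The factor is [1 - lam Tr B = q ^ (- 2 p)]. *)
Lemma CB_scalar : C *m B = (q ^- (p + p)%N)%:M.
Proof.
have E : B *m C = (q ^- (p + p)%N)%:M.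
  rewrite (BC_scalar q0 R_YB R_hecke skew) trB_rank; congr _%:M.
  rewrite mulrCA qnumV // mulrBr mulVf ?expf_neq0 // opprB addrC subrK.
  by rewrite -invfM -exprD.
have qp : q ^- (p + p)%N != 0 by rewrite invr_eq0 expf_neq0.
have : (q ^+ (p + p)%N *: B) *m C = 1%:M.
  by rewrite -scalemxAl E scale_scalar_mx mulfV // expf_neq0.
move/mulmx1C; rewrite -scalemxAr => /(congr1 ( *:%R (q ^- (p + p)%N))).
by rewrite scalerA mulVf ?scale1r ?expf_neq0 // scale_scalar_mx mulr1 => ->.
Qed.

(** The vanishing of [A^(p+1)], read between [v] and [u], evaluates
    [Tr_2 R_12 Z_2] for the matrix [Z] of these pairings; [skew_inj] then
    identifies [Z]. *)
Lemma rblk_cblk_C b l : (v_ l *m u_ b) 0 0 = q ^+ p / qnum q p * C b l.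
Proof.
pose Z : 'M_n := \matrix_(b, l) (v_ l *m u_ b) 0 0.
have -> : (v_ l *m u_ b) 0 0 = Z b l by rewrite [RHS]mxE.
have qp := qnum_neq0 q0 q_generic m.+1.
rewrite (@skew_inj _ _ _ _ skew Z (q ^+ p / qnum q p)) ?mxE // => x z.
have := antisym_rec q0 q_generic (idA m.+1); rewrite Ap1 scaler0.
move/(congr1 (fun X => v *m blk X x z *m u)).
rewrite blkD blkN !blkZ blk_mulshift blk_shiftmul blk_shift Ap_uv.
rewrite -(scale0r 0) blkZ scale0r mulmx0 mul0mx mulmxBr mulmxBl.
rewrite -!scalemxAr -!scalemxAl !mulmxA rank1_pairing !mul1mx rank1_pairing.
rewrite -[_ *m v *m u]mulmxA rank1_pairing mulmx1 -mulmxA row_colM.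
set S := \sum_c _ => /matrixP/(_ 0 0); rewrite !mxE eqxx mulr1n mulr1.
move/esym/eqP; rewrite subr_eq0 summxE => /eqP E.
rewrite mulrAC E [X in X / _]mulrC mulfK //; apply: eq_bigr => s _.
rewrite cblkM mulmx_sumr summxE; apply: eq_bigr => t _.
by rewrite blk2_at2 mul_scalar_mx -scalemxAr !mxE.
Qed.


(** The heart of the equivalence: on the columns [u_b] the compressed B-type
    operator is [q I - R] in disguise.  The [x, z] block of [antisym_rec_inv]
    applied to [u_b] produces a multiple of [C b z] times [u_x] through
    [rblk_cblk_C]; summing against [B R], the left-hand side becomes the
    operator by [weighted_invR] and the product [C B] is a scalar. *)
Lemma intertwine_u i j b :
  q ^+ p * qnum q m.+1 *: (A *m on_first m.+1 (pi_t Psi i j) *m u_ b) =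
  (q * (i == j)%:R) *: u_ b - \sum_x r b i x j *: u_ x.
Proof.
have E x z : q ^+ p * qnum q m.+1 *:
      (A *m blk (first2 m (invR q R)) x z *m u_ b) =
    (q * (x == z)%:R) *: u_ b - (q ^+ (p + p)%N * C b z) *: u_ x.
  have qp := qnum_neq0 q0 q_generic m.+1.
  have := congr1 (fun X => blk X x z *m u_ b) (antisym_rec_inv m).
  rewrite Ap_uv blkZ blkD blkN !blkZ blk_mulshift blk_shiftmul blk_shift.
  rewrite blk_outer mulmxBl -!scalemxAl -!mulmxA antisym_cblk !mulmxA => ->.
  rewrite scalerA; congr (_ - _).
  rewrite -mulmxA [v_ z *m _]mx11_scalar rblk_cblk_C.
  rewrite mul_mx_scalar scalerA; congr (_ *: _); rewrite exprD.
  by move: (q ^+ p) => y; field.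
(* The entries of B_1 R_12 with the second factor fixed. *)
pose W z x := \sum_a B z a * r a i x j.
rewrite -weighted_invR mulmx_sumr mulmx_suml scaler_sumr.
transitivity (\sum_x \sum_z W z x *: ((q * (x == z)%:R) *: u_ b -
    (q ^+ (p + p)%N * C b z) *: u_ x)).
  apply: eq_bigr => x _; rewrite mulmx_sumr mulmx_suml scaler_sumr.
  apply: eq_bigr => z _; rewrite -E -scalemxAr -scalemxAl.
  by rewrite [LHS]scalerA [RHS]scalerA [W z x * _]mulrC.
have -> : (q * (i == j)%:R) *: u_ b =
    \sum_x \sum_z W z x *: ((q * (x == z)%:R) *: u_ b).
  rewrite -(trB_R skew) mulr_sumr scaler_suml; apply: eq_bigr => x _.
  rewrite [RHS](bigD1 x) //= eqxx [X in _ = _ + X]big1 ?addr0 => [|z /negPf].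
    by rewrite scalerA mulr1 mulrC.
  by rewrite eq_sym => ->; rewrite mulr0 scale0r scaler0.
rewrite -sumrB; apply: eq_bigr => x _.
have -> : r b i x j *: u_ x =
    \sum_z W z x *: ((q ^+ (p + p)%N * C b z) *: u_ x).
  under eq_bigr do rewrite scalerA.
  rewrite -scaler_suml; congr (_ *: _).
  transitivity (\sum_a (q ^+ (p + p)%N * (C *m B) b a) * r a i x j).
    rewrite (bigD1 b) //= CB_scalar mxE eqxx mulfV ?expf_neq0 // mul1r.
    rewrite big1 ?addr0 // => a /negPf; rewrite mxE eq_sym => ->.
    by rewrite mulr0 mul0r.
  under [RHS]eq_bigr do rewrite mulr_suml.
  rewrite [RHS]exchange_big; apply: eq_bigr => a _; rewrite mxE.
  rewrite mulr_sumr mulr_suml; apply: eq_bigr => z _ /=; ring.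
by rewrite -sumrB; apply: eq_bigr => z _; rewrite scalerBr.
Qed.

(** The weighted trace of the recursion for [A^(p)] is a nonzero multiple of
    [A^(p-1)], which is therefore spanned by the blocks of [u] and [v]. *)
Lemma trB_uv : \sum_l \sum_b B l b *: (u_ b *m v_ l) = q ^- p / qnum q p *: A.
Proof.
have qp := qnum_neq0 q0 q_generic m.+1.
apply: (scalerI qp); transitivity (wtrace B (qnum q p *: asym p)).
  rewrite wtraceZ; congr (_ *: _); apply: eq_bigr => l _; apply: eq_bigr => b _.
  by rewrite Ap_uv blk_outer.
rewrite antisym_rec // wtraceD -scaleNr !wtraceZ wtrace_mulshift wtrace_shiftmul.
rewrite (wtrace_first2 _ (trB_R skew)) mulmx1 idA.
rewrite -[shift _]mul1mx wtrace_mulshift wtrace_scalar mulr1 mul_scalar_mx trB_rank.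
rewrite !scalerA -scalerDl; congr (_ *: _); rewrite [RHS]mulrC divfK //.
rewrite qnumS_inv // [q ^+ p]exprS; move: (q ^+ m.+1) (expf_neq0 m.+1 q0) => y y0.
by field; rewrite q0 y0.
Qed.

Definition to_cV (x : 'rV[F]_#|{ffun 'I_m.+1 -> 'I_n}|) : 'cV[F]_n :=
  \col_b (x *m u_ b) 0 0.

(** The inverse of [to_cV] on the antisymmetric rows, by [trB_uv]; the other
    composite is the identity because [C B] is a scalar. *)
Definition of_cV (y : 'cV[F]_n) : 'rV[F]_#|{ffun 'I_m.+1 -> 'I_n}| :=
  (q ^- p / qnum q p)^-1 *: \sum_l (B *m y) l 0 *: (v_ l *m A).

Definition theta_mx i j : 'M[F]_n := \matrix_(a, b) - r a i b j.

Lemma to_cV_linear : linear to_cV.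
Proof.
by move=> c x y; apply/colP=> b; rewrite [LHS]mxE mulmxDl -scalemxAl !mxE.
Qed.

Let kap0 : q ^- p / qnum q p != 0.
Proof. by rewrite mulf_neq0 ?invr_eq0 ?expf_neq0 ?qnum_neq0. Qed.

Lemma to_cVK x : x *m A = x -> of_cV (to_cV x) = x.
Proof.
move=> xA; rewrite /of_cV; apply: (scalerI kap0); rewrite scalerA mulfV // scale1r.
have -> : q ^- p / qnum q p *: x = x *m (q ^- p / qnum q p *: A) *m A.
  by rewrite -scalemxAr -scalemxAl !xA.
rewrite -trB_uv mulmx_sumr mulmx_suml; apply: eq_bigr => l _.
rewrite mulmx_sumr mulmx_suml mxE scaler_suml; apply: eq_bigr => b _.
rewrite -scalemxAr -scalemxAl mulmxA [x *m u_ b]mx11_scalar.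
by rewrite mul_scalar_mx -scalemxAl scalerA [to_cV x b 0]mxE.
Qed.

Lemma of_cVK y : to_cV (of_cV y) = y.
Proof.
apply/colP=> b; rewrite mxE /of_cV -scalemxAl mulmx_suml mxE summxE.
have E l : ((B *m y) l 0 *: (v_ l *m A) *m u_ b) 0 0 =
    q ^+ p / qnum q p * (C b l * (B *m y) l 0).
  by rewrite -scalemxAl -mulmxA antisym_cblk mxE rblk_cblk_C; ring.
under eq_bigr do rewrite E.
rewrite -mulr_sumr.
have -> : \sum_l C b l * (B *m y) l 0 = (C *m (B *m y)) b 0 by rewrite mxE.
rewrite mulmxA CB_scalar mul_scalar_mx mxE exprD.
have := qnum_neq0 q0 q_generic m.+1; have := expf_neq0 p q0.
by move: (q ^+ p) (qnum q p) => z w z0 w0; field; rewrite z0 w0 oner_eq0.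
Qed.

(** Transported to columns, the operator of [l_i^j] is an affine function of its
    R-type operator, with coefficients independent of [i] and [j]. *)
Lemma to_cV_pi i j x : to_cV (x *m pi_antisym_t q R Psi m.+1 i j) =
  q ^- 2 *: ((q * (i == j)%:R)%:M + theta_mx i j) *m to_cV x.
Proof.
have q20 : q ^+ 2 != 0 by rewrite expf_neq0.
pose f (w : 'cV_#|{ffun 'I_m.+1 -> 'I_n}|) : F := (x *m w) 0 0.
have fZ c w : f (c *: w) = c * f w by rewrite /f -scalemxAr mxE.
have fB w w' : f (w - w') = f w - f w'.
  by rewrite /f mulmxBr [LHS]mxE; congr (_ + _); rewrite mxE.
have fS (g : 'I_n -> 'cV_#|{ffun 'I_m.+1 -> 'I_n}|) :
    f (\sum_c g c) = \sum_c f (g c).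
  by rewrite /f mulmx_sumr summxE.
have psiE c : to_cV x c 0 = f (u_ c) by rewrite mxE.
apply/colP=> b; have := congr1 f (intertwine_u i j b).
rewrite fZ fB fS fZ -psiE => E.
have psi_mul : to_cV (x *m pi_antisym_t q R Psi m.+1 i j) b 0 =
    q ^+ m * qnum q m.+1 * f (A *m on_first m.+1 (pi_t Psi i j) *m u_ b).
  by rewrite [LHS]mxE /pi_antisym_t -fZ /f -!scalemxAr -!mulmxA -scalemxAl
    -!mulmxA antisym_cblk.
rewrite psi_mul -scalemxAl [RHS]mxE; apply: (mulfI q20).
rewrite [RHS]mulrA mulfV // mul1r.
rewrite [LHS]mulrA [q ^+ 2 * (q ^+ m * _)]mulrA -exprD add2n E.
rewrite mulmxDl mul_scalar_mx [RHS]mxE; congr (_ + _); first by rewrite [RHS]mxE.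
rewrite [RHS]mxE -sumrN; apply: eq_bigr => c _.
by rewrite fZ -psiE [in RHS]mxE mulNr.
Qed.

End RankOne.

(** * Lifting matrices to representations of the algebras *)

Section QuotientLift.
Variables (F : fieldType) (A B : algType F) (S : A -> Prop).
Variables (S1 : ~ ideal_gen S 1) (f : {lrmorphism A -> B}).
Hypothesis f0 : forall x, S x -> f x = 0.

Lemma lift_ideal0 x : ideal_gen S x -> f x = 0.
Proof.
elim=> {x} [x /f0 //||x y _ x0 _ y0|a x _ x0|a x _ x0].
- exact: rmorph0.
- by rewrite rmorphD /= x0 y0 addr0.
- by rewrite rmorphM /= x0 mulr0.
- by rewrite rmorphM /= x0 mul0r.
Qed.

Let g (x : quot_alg S1) : B := f (quot_repr x).

Let gE x : g (quot_proj S1 x) = f x.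
Proof.
apply/eqP; rewrite -subr_eq0 -rmorphB; apply/eqP/lift_ideal0.
exact: quot_repr_proj.
Qed.

Let g_zmod : zmod_morphism g.
Proof.
move=> x y; rewrite -[x]quot_reprK -[y]quot_reprK.
by rewrite -(rmorphB (quot_proj S1)) !gE rmorphB.
Qed.

Let g_scale : scalable g.
Proof. by move=> c x; rewrite -[x]quot_reprK quot_scalE !gE linearZ. Qed.

Let g_monoid : monoid_morphism g.
Proof.
split=> [|x y]; first by rewrite -(rmorph1 (quot_proj S1)) gE rmorph1.
by rewrite -[x]quot_reprK -[y]quot_reprK quot_mulE !gE rmorphM.
Qed.

Lemma quot_lift : exists h : {lrmorphism quot_alg S1 -> B},
  forall x, h (quot_proj S1 x) = f x.
Proof.
pose gZ := GRing.isZmodMorphism.Build _ _ g g_zmod.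
pose gM := GRing.isMonoidMorphism.Build _ _ g g_monoid.
pose gL := GRing.isScalable.Build _ _ _ _ g g_scale.
pose h : {lrmorphism quot_alg S1 -> B} := HB.pack g gZ gM gL.
by exists h => x; apply: gE.
Qed.

End QuotientLift.

Section FreeLift.
Variables (F : fieldType) (n : nat) (A : algType F) (T : 'M[A]_n).
Local Notation mon := {fmonom ('I_n * 'I_n)%type}.

Let word (w : mon) : A := \prod_(x <- (w : seq _)) T x.1 x.2.

Let word_mmorph : mmorphism word.
Proof.
split=> [v w|]; rewrite /word; first by rewrite fmM big_cat.
by rewrite fm1 big_nil.
Qed.

Lemma free_lift : exists f : {lrmorphism free_alg F n -> A},
  forall i j, f (free_gen F i j) = T i j.
Proof.
pose hM := isMultiplicative.Build mon A word word_mmorph.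
pose h : {mmorphism mon -> A} := HB.pack word hM.
pose g : free_alg F n -> A := mmap (in_alg A) h.
have gZ : zmod_morphism g by move=> x y; apply: (raddfB (mmap (in_alg A) h)).
have gS : scalable g.
  move=> c x; rewrite /g; have := @mmapZ mon F A (in_alg A) h c x.
  by rewrite /= => ->; rewrite mulr_algl.
have gM : monoid_morphism g.
  have comm (x : {malg F[mon]}) k k' : GRing.comm (in_alg A x@_k) (h k').
    by rewrite /GRing.comm /= mulr_algl mulr_algr.
  have [gm g1] := commr_mmap_is_multiplicative comm.
  by split.
pose mZ := GRing.isZmodMorphism.Build _ _ g gZ.
pose mM := GRing.isMonoidMorphism.Build _ _ g gM.
pose mS := GRing.isScalable.Build _ _ _ _ g gS.
pose f : {lrmorphism free_alg F n -> A} := HB.pack g mZ mM mS.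
exists f => i j; rewrite /= /g mmapU /= scale1r mul1r /word.
by rewrite fmU big_seq1.
Qed.

End FreeLift.

Section Lifts.
Variables (F : fieldType) (n : nat) (R Psi : tmx F n 2).
Variables (A : algType F) (T : 'M[A]_n).
Hypothesis T_rea : rea_relmx R T = 0.

Lemma Lq_lift : exists f : {lrmorphism Lq R -> A},
  forall i j, f (lgen R i j) = T i j.
Proof.
have [f fT] := free_lift T.
have f0 x : rea_rel R x -> f x = 0.
  move=> [I [J ->]]; set L := (\matrix_(i, j) _).
  have E : map_mx f L = T by apply/matrixP=> i j; rewrite !mxE fT.
  have := map_rea_relmx f R L; rewrite E T_rea => /matrixP.
  by move/(_ (enum_rank I) (enum_rank J)); rewrite [LHS]mxE [RHS]mxE.
have [h hE] := quot_lift (@rea_proper F n R) f0.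
by exists h => i j; rewrite hE.
Qed.

Lemma map_qtrace (A' B' : algType F) (f : {lrmorphism A' -> B'}) (L : 'M[A']_n) :
  f (qtrace Psi L) = qtrace Psi (map_mx f L).
Proof.
rewrite /qtrace /mxtrace rmorph_sum; apply: eq_bigr => i _.
rewrite !mxE rmorph_sum; apply: eq_bigr => j _.
by rewrite rmorphM !mxE; congr (_ * _); apply: rmorph_alg.
Qed.

Lemma SLq_lift : qtrace Psi T = 0 -> exists f : {lrmorphism SLq R Psi -> A},
  forall i j, f (fgen R Psi i j) = T i j.
Proof.
move=> T0; have [f fT] := Lq_lift.
have f0 x : @sl_rel F n R Psi x -> f x = 0.
  move=> ->; rewrite map_qtrace -[RHS]T0; congr qtrace.
  by apply/matrixP=> i j; rewrite !mxE.
have [h hE] := quot_lift (@sl_proper F n R Psi) f0.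
by exists h => i j; rewrite hE.
Qed.

End Lifts.

Section MatrixRepresentation.
Variables (F : fieldType) (n : nat) (A : algType F).
Variables (f : {lrmorphism A -> 'M[F]_n.+1}).
Variables (W : vectType F) (to : {linear W -> 'cV[F]_n.+1}).
Variables (from : {linear 'cV[F]_n.+1 -> W}).
Hypotheses (toK : cancel to from) (fromK : cancel from to).

Let act (x : A) : 'End(W) :=
  (linfun from \o linfun (mulmx (f x)) \o linfun to)%VF.

Let actE x w : act x w = from (f x *m to w).
Proof. by rewrite !comp_lfunE !lfunE. Qed.

Lemma mx_representation : exists rho : representation A W,
  forall x w, rho x w = from (f x *m to w).
Proof.
have actL : linear act.
  move=> c x y; apply/lfunP=> w; rewrite add_lfunE scale_lfunE !actE.
  by rewrite linearP mulmxDl -scalemxAl linearP.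
pose mL := GRing.isLinear.Build _ _ _ _ act actL.
pose a : {linear A -> 'End(W)} := HB.pack act mL.
have act1 : a 1 = \1%VF.
  by apply/lfunP=> w; rewrite id_lfunE [LHS]actE rmorph1 mul1mx toK.
have actM x y : a (x * y) = (a x \o a y)%VF.
  apply/lfunP=> w; rewrite comp_lfunE [LHS]actE.
  by rewrite [in RHS]actE [a y w]actE fromK rmorphM -mulmxE mulmxA.
by exists (Representation act1 actM) => x w; apply: actE.
Qed.

End MatrixRepresentation.

(** * Affine shifts of the R-type representation *)

Section Unroll.
Variables (F : fieldType) (n : nat).
Local Notation alg := 'M[F]_n.+1.

(** A matrix over the multi-indices with entries in a matrix algebra is an
    operator with one more tensor factor, placed first; the reflection equation
    becomes an identity between numerical operators in three factors. *)
Definition unroll k (Y : tmx alg n.+1 k) : tmx F n.+1 k.+1 :=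
  tmk (fun I J => tent Y (ttail I) (ttail J) (I ord0) (J ord0)).

Lemma tent_unroll k (Y : tmx alg n.+1 k) a b I J :
  tent (unroll Y) (tcons a I) (tcons b J) = tent Y I J a b.
Proof. by rewrite tent_tmk !ttail_tcons !tcons0. Qed.

Lemma unroll_inj k : injective (@unroll k).
Proof.
move=> X Y E; apply: tmxP => I J; apply/matrixP=> a b.
by rewrite -!tent_unroll E.
Qed.

Lemma unrollB k (X Y : tmx alg n.+1 k) : unroll (X - Y) = unroll X - unroll Y.
Proof.
apply: tmxP => I J; rewrite tentD tentN -[I]tconsK -[J]tconsK !tent_unroll.
by rewrite tentD tentN !mxE.
Qed.

Lemma unrollM k (X Y : tmx alg n.+1 k) : unroll (X *m Y) = unroll X *m unroll Y.
Proof.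
apply: tmxP => I J; rewrite tentM -[I]tconsK -[J]tconsK tent_unroll tentM.
rewrite big_tcons exchange_big summxE; apply: eq_bigr => K _.
by rewrite -mulmxE mxE; apply: eq_bigr => c _; rewrite !tent_unroll.
Qed.

Lemma unroll_scalars k (X : tmx F n.+1 k) :
  unroll (map_mx (in_alg alg) X) = shift X.
Proof.
apply: blkP => a b; apply: tmxP => I J.
rewrite tent_blk tent_unroll blk_shift tentZ /tent !mxE.
by case: eqP => _; rewrite ?mulr1n ?mulr0n mulrC.
Qed.

Variables (q : F) (R Psi : tmx F n.+1 2).
Hypotheses (q0 : q != 0) (R_YB : yang_baxter R) (R_hecke : hecke q R).
Hypothesis skew : skew_inverse R Psi.
Local Notation lam := (q - q^-1).

(** The images of the generators under [L |-> a theta(L) + b I]; the B-type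
    representation and both sl-reductions belong to this family. *)
Definition affine_theta (a b : F) : 'M[alg]_n.+1 :=
  \matrix_(i, j) (a *: theta_mx R i j + (b * (i == j)%:R)%:M).

Lemma unroll_theta a b :
  unroll (on_first 2 (affine_theta a b)) = b%:M - a *: first2 1 R.
Proof.
apply: blkP => x y; apply: blkP => i j; apply: blkP => k l; apply: tmxP => I J.
rewrite !blkD !blkN !blkZ blk2_at2 !blk_scalar tentD tentN tentZ !tent_scalar.
rewrite !tent_blk tent_unroll -!tent_blk blk_on_first blk_scalar tent_scalar.
have -> : I = J by apply/ffunP=> -[].
rewrite eqxx; case: (k == l); rewrite !mxE /=; case: (x == y); case: (i == j);
  by rewrite ?mulr0n ?mulr1n ?mxE; ring.
Qed.

(** With [S = R_23], [X = R_12] and [L = b - a X], the braid and Hecke relations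
    reduce the defect of the reflection equation to
    [a (1 - a - lam b) (S X - X S)]. *)
Lemma affine_theta_rea a b :
  a + lam * b = 1 -> rea_relmx R (affine_theta a b) = 0.
Proof.
move=> ab1; apply: unroll_inj; rewrite /rea_relmx !(unrollB, unrollM).
rewrite unroll_scalars unroll_theta.
have -> : unroll (0 : tmx alg n.+1 2) = 0.
  by rewrite -(subrr (0 : tmx alg n.+1 2)) unrollB subrr.
have XX := first2_hecke q0 R_hecke 1; have br := first2_braid R_YB 0.
have SS : shift R *m shift R = lam *: shift R + 1%:M.
  by rewrite -shiftM (hecke_sqr q0 R_hecke) /shift embD embZ emb_scalar.
rewrite first2_id in br.
set X := first2 1 R in XX br *; set S := shift R in SS br *.
have SXSX : S *m X *m S *m X = lam *: (X *m S *m X) + X *m S.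
  by rewrite -br -mulmxA XX mulmxDr mulmx1 -scalemxAr.
have XSXS : X *m S *m X *m S = lam *: (X *m S *m X) + S *m X.
  rewrite -!mulmxA !(mulmxA S) -br -!mulmxA (mulmxA X X) XX mulmxDl mul1mx.
  by rewrite -scalemxAl !mulmxA.
have SSX : S *m S *m X = lam *: (S *m X) + X.
  by rewrite SS mulmxDl mul1mx -scalemxAl.
have XSS : X *m S *m S = lam *: (X *m S) + X.
  by rewrite -mulmxA SS mulmxDr mulmx1 -scalemxAr.
set L := b%:M - a *: X; have SL : S *m L = b *: S - a *: (S *m X).
  by rewrite mulmxBr mul_mx_scalar -scalemxAr.
have LS : L *m S = b *: S - a *: (X *m S).
  by rewrite mulmxBl mul_scalar_mx -scalemxAl.
rewrite -(mulmxA _ S L) -(mulmxA _ L S) SL LS !mulmxBl !mulmxBr.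
rewrite -!scalemxAl -!scalemxAr !mulmxA SXSX XSXS SSX XSS SS.
rewrite -br; move: (X *m S *m X) (X *m S) (S *m X) => Y U V.
have -> : a = 1 - lam * b by rewrite -ab1 addrK.
apply/matrixP=> i j; rewrite !mxE.
ring.
Qed.

Lemma qtrace_affine_theta a b :
  qtrace Psi (affine_theta a b) = (b * \tr (Cmx Psi) - a)%:M.
Proof.
apply/matrixP=> x y; rewrite /qtrace /mxtrace summxE.
transitivity (\sum_i \sum_j Cmx Psi i j *
  (- a * rent R x j y i + b * (j == i)%:R * (x == y)%:R)).
  apply: eq_bigr => i _; rewrite mxE summxE; apply: eq_bigr => j _.
  rewrite [map_mx _ _ _ _]mxE mulr_algl mxE [affine_theta _ _ _ _]mxE.
  by move: (Cmx Psi i j) => c; rewrite !mxE -[(_ * _) *+ _]mulr_natr mulrN mulNr.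
rewrite mxE /mxtrace -mulr_natr.
transitivity (\sum_i (b * (x == y)%:R * Cmx Psi i i -
    a * \sum_j rent R x j y i * Cmx Psi i j)).
  apply: eq_bigr => i _; rewrite mulr_sumr.
  transitivity (\sum_j (b * (x == y)%:R * Cmx Psi i j * (j == i)%:R -
      a * (rent R x j y i * Cmx Psi i j))); first by apply: eq_bigr => j _; ring.
  rewrite sumrB; congr (_ - _); rewrite (bigD1 i) //= eqxx mulr1 big1 ?addr0 //.
  by move=> j /negPf ->; rewrite mulr0.
rewrite sumrB -!mulr_sumr exchange_big (trC_R skew).
ring.
Qed.

Lemma affine_theta_shift a b c d i j (y : 'cV[F]_n.+1) :
  c *: (affine_theta a b i j *m y - ((i == j)%:R * d) *: y) =
  affine_theta (c * a) (c * (b - d)) i j *m y.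
Proof.
rewrite -[(_ * d) *: y]mul_scalar_mx -mulmxBl scalemxAl; congr (_ *m _).
rewrite ![affine_theta _ _ _ _]mxE -addrA -raddfB scalerDr scalerA /=.
by rewrite scale_scalar_mx; congr (_ + _%:M); ring.
Qed.

End Unroll.

Lemma rank1_outer (F : fieldType) a b (M : 'M[F]_(a, b)) :
  \rank M = 1%N -> exists u : 'cV_a, exists v : 'rV_b, M = u *m v.
Proof.
move=> rk; have := mulmx_base M; move: (col_base M) (row_base M).
by rewrite rk => u v <-; exists u, v.
Qed.

Lemma antisym_spaceP (F : fieldType) n q (R : tmx F n 2) k
    (x : 'rV_#|{ffun 'I_k.+1 -> 'I_n}|) :
  reflect (exists y, x = y *m antisym q R k.+1) (x \in antisym_space q R k.+1).
Proof.
by apply: (iffP memv_imgP) => [[y _ ->]|[y ->]]; exists y;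
  rewrite ?memvf ?lfunE.
Qed.

(** * The equivalence *)

Section Equivalence.
Variables (F : fieldType) (n' m : nat) (q : F).
Local Notation n := n'.+1.
Local Notation p := m.+2.
Variables (R Psi : tmx F n 2).
Hypotheses (q0 : q != 0) (q_generic : forall k, (0 < k)%N -> q ^+ k != 1).
Hypotheses (R_YB : yang_baxter R) (R_hecke : hecke q R).
Hypothesis skew : skew_inverse R Psi.
Hypothesis rank_p : symmetry_rank q R p.
Hypothesis omega_cond : qnum q p.-1 + q ^+ (p + 2) != 0.

Local Notation lam := (q - q^-1).
Local Notation trC := (\tr (Cmx Psi)).
Local Notation W := (subvs_of (antisym_space q R m.+1)).

Lemma theta_pi_equivalent :
  exists (theta : representation (Lq R) 'cV[F]_n)
         (thetabar : representation (SLq R Psi) 'cV[F]_n)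
         (pi : representation (Lq R) W)
         (pibar : representation (SLq R Psi) W),
    [/\ is_theta1 theta, sl_reduction q theta thetabar, is_pi_antisym Psi pi,
        sl_reduction q pi pibar & equivalent thetabar pibar].
Proof.
have [Ap1 rk] := rank_p; have [u [v Ap_uv]] := rank1_outer rk.
have Ap0 : antisym q R p != 0 by rewrite -mxrank_eq0 rk.
have idA := antisym_idem q0 q_generic R_YB R_hecke m.
have trCE : trC = q ^- p * qnum q p.
  by rewrite -tr_BC (trB_rank q0 q_generic R_YB R_hecke skew Ap0 Ap1).
have qp0 := qnum_neq0 q0 q_generic m.+1.
have trC0 : trC != 0 by rewrite trCE mulf_neq0 // invr_eq0 expf_neq0.
(* The factor of the sl-reduction of theta, where the quantum trace acts by -1. *)
pose omega := 1 + lam / trC.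
have omega0 : omega != 0.
  apply: contra omega_cond => /eqP om0; apply/eqP.
  have := congr1 ( *%R (q * qnum q p)) om0; rewrite mulr0 /omega trCE => <-.
  have -> : q * qnum q p * (1 + lam / (q ^- p * qnum q p)) =
      q * qnum q p + q * lam * q ^+ p.
    by move: (q ^+ p) (expf_neq0 p q0) (qnum q p) qp0 => y y0 w w0; field;
      rewrite ?w0 ?y0 ?q0 ?oner_eq0.
  rewrite /= (qnumS q0 q_generic m.+1) addn2 !exprS.
  move: (qnum q m.+1) (q ^+ m) => nm y.
  by field.
pose to (w : W) : 'cV[F]_n := to_cV u (vsval w).
have to_lin : linear to by move=> c x y; rewrite /to linearP to_cV_linear.
pose spread := of_cV q R Psi v.
have spread_in y : spread y \in antisym_space q R m.+1.
  apply/antisym_spaceP.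
  exists ((q ^- p / qnum q p)^-1 *: \sum_l (Bmx Psi *m y) l 0 *: rblk v l).
  rewrite -scalemxAl mulmx_suml; congr (_ *: _); apply: eq_bigr => l _.
  by rewrite -scalemxAl.
pose from (y : 'cV[F]_n) : W := vsproj (antisym_space q R m.+1) (spread y).
have fromE y : vsval (from y) = spread y by rewrite vsprojK.
have spread_lin : linear spread.
  move=> c x y; rewrite /spread /of_cV [c *: (_ *: _)]scalerA [c * _]mulrC.
  rewrite -[(_ * c) *: _]scalerA -scalerDr; congr (_ *: _).
  rewrite scaler_sumr -big_split; apply: eq_bigr => l _ /=.
  by rewrite mulmxDr -scalemxAr !mxE scalerDl scalerA.
have from_lin : linear from by move=> c x y; rewrite /from spread_lin linearP.
pose toL : {linear W -> 'cV[F]_n} :=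
  HB.pack to (GRing.isLinear.Build _ _ _ _ to to_lin).
pose fromL : {linear 'cV[F]_n -> W} :=
  HB.pack from (GRing.isLinear.Build _ _ _ _ from from_lin).
have stable (w : W) : vsval w *m antisym q R m.+1 = vsval w.
  by have /antisym_spaceP[y ->] := subvsP w; rewrite -mulmxA idA.
have toK : cancel toL fromL.
  move=> w; apply: val_inj; rewrite /= fromE.
  exact: (to_cVK q0 q_generic R_YB R_hecke skew Ap_uv Ap0 Ap1).
have fromK : cancel fromL toL.
  move=> y; rewrite /= /to fromE.
  exact: (of_cVK q0 q_generic R_YB R_hecke skew Ap_uv Ap0 Ap1).
pose T := affine_theta R.
have lift a b (ab1 : a + lam * b = 1) :=
  Lq_lift (affine_theta_rea q0 R_YB R_hecke ab1).
have [|f1 f1E] := lift 1 0; first by rewrite mulr0 addr0.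
(* The coefficients are those of to_cV_pi. *)
have [|f2 f2E] := lift (q ^- 2) q^-1.
  by field.
have ab_bar : omega^-1 + lam * (omega^-1 / trC) = 1.
  by rewrite mulrCA -{1}[omega^-1]mulr1 -mulrDr mulVf.
have qt_bar : qtrace Psi (T omega^-1 (omega^-1 / trC)) = 0.
  by rewrite qtrace_affine_theta // divfK // subrr raddf0.
have [f3 f3E] := SLq_lift (affine_theta_rea q0 R_YB R_hecke ab_bar) qt_bar.
have idK : cancel (@idfun 'cV[F]_n) idfun by [].
have [theta thetaE] :=
  mx_representation f1 (to := idfun) (from := idfun) idK idK.
have [thetabar thetabarE] :=
  mx_representation f3 (to := idfun) (from := idfun) idK idK.
have [pi piE] := mx_representation f2 toK fromK.
have [pibar pibarE] := mx_representation f3 toK fromK.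
exists theta, thetabar, pi, pibar.
have qtE (f : {lrmorphism Lq R -> 'M[F]_n}) a b :
    (forall i j, f (lgen R i j) = T a b i j) ->
    f (qtrace Psi (Lqmx R)) = (b * trC - a)%:M.
  move=> fE; rewrite map_qtrace -(qtrace_affine_theta skew); congr qtrace.
  by apply/matrixP=> i j; rewrite !mxE fE mxE.
split.
- move=> i j w; rewrite thetaE f1E /= mxE scale1r mul0r raddf0 addr0.
  by congr (_ *m _); apply/matrixP=> a b; rewrite !mxE.
- have omE : 1 - lam * (-1) / trC = omega by rewrite mulrN1 mulNr opprK.
  exists (-1) => /=; rewrite omE; split=> //.
    apply/lfunP=> w; rewrite thetaE (qtE _ _ _ f1E) mul0r sub0r mul_scalar_mx.
    by rewrite scale_lfunE id_lfunE.
  move=> i j; apply/lfunP=> w; rewrite thetabarE f3E.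
  rewrite scale_lfunE add_lfunE opp_lfunE scale_lfunE id_lfunE thetaE f1E /=.
  rewrite affine_theta_shift; congr (affine_theta _ _ _ _ _ *m _).
    by rewrite mulr1.
  by rewrite sub0r mulNr opprK mul1r.
- move=> i j w; rewrite piE f2E /= fromE.
  rewrite -[RHS](to_cVK q0 q_generic R_YB R_hecke skew Ap_uv Ap0 Ap1); last first.
    by rewrite /pi_antisym_t -scalemxAr -scalemxAl -!mulmxA idA.
  congr (of_cV _ _ _ _ _).
  rewrite (to_cV_pi q0 q_generic R_YB R_hecke skew Ap_uv Ap0 Ap1).
  congr (_ *m _); rewrite mxE addrC scalerDr scale_scalar_mx mulrA.
  by congr (_ %:M + _); congr (_ * _); field.
  (* Both reductions are the member of the affine family of quantum trace 0. *)
- pose chi := q^-1 * trC - q ^- 2.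
  have chiE : chi / trC = q^-1 - q ^- 2 / trC by rewrite mulrBl mulfK.
  have omE : 1 - lam * chi / trC = q ^- 2 * omega.
    by rewrite -mulrA chiE /omega; field; rewrite trC0 q0.
  exists chi => /=; rewrite omE; split.
  + apply/lfunP=> w; rewrite piE (qtE _ _ _ f2E) mul_scalar_mx linearZ.
    by rewrite [fromL _]toK scale_lfunE id_lfunE.
  + by rewrite mulf_neq0 // invr_eq0 expf_neq0.
  move=> i j; apply/lfunP=> w; rewrite pibarE f3E.
  rewrite scale_lfunE add_lfunE opp_lfunE scale_lfunE id_lfunE piE f2E.
  rewrite -{3}[w]toK -linearZ -linearB -linearZ affine_theta_shift chiE.
  have e1 : (q ^- 2 * omega)^-1 * q ^- 2 = omega^-1.
    by rewrite invfM mulrAC mulVf ?mul1r // invr_eq0 expf_neq0.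
  by rewrite opprB addrCA subrr addr0 mulrA e1.
- exists fromL; first by exists toL.
  by move=> x w; rewrite thetabarE pibarE fromK.
Qed.

End Equivalence.

Theorem proposition8 (K : realType) (n p : nat) (q : K[i])
    (R Psi : tmx K[i] n 2) :
  (0 < n)%N ->
  q != 0 ->
  (forall k : nat, (0 < k)%N -> q ^+ k != 1) ->
  yang_baxter R ->
  hecke q R ->
  skew_inverse R Psi ->
  symmetry_rank q R p ->
  (2 <= p)%N ->
  qnum q p.-1 + q ^+ (p + 2) != 0 ->
  exists (theta : representation (Lq R) 'cV[K[i]]_n)
         (thetabar : representation (SLq R Psi) 'cV[K[i]]_n)
         (pi : representation (Lq R) (subvs_of (antisym_space q R p.-1)))
         (pibar : representation (SLq R Psi)
                    (subvs_of (antisym_space q R p.-1))),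
    [/\ is_theta1 theta,
        sl_reduction q theta thetabar,
        is_pi_antisym Psi pi,
        sl_reduction q pi pibar
      & equivalent thetabar pibar].
Proof.
case: n R Psi => [//|n] R Psi _; case: p => [|[|m]] // q0 q_generic R_YB R_hecke.
by move=> skew rank_p _ omega_cond; apply: theta_pi_equivalent.
Qed.
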